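(* Let $h\in\mathbb R[x_1,\ldots,x_n]$ be irreducible, homogeneous and hyperbolic in direction $e\in\mathbb R^n$. If $-1\notin\Sigma^2\mathcal A_e(h)$, then $\Lambda_e(h)$ is spectrahedral, i.e. there are hermitian matrices $M_1,\ldots,M_n$ (of some size) with $\Lambda_e(h)=\{a\in\mathbb R^n: a_1M_1+\cdots+a_nM_n\succeq 0\}$.
   Context: A homogeneous polynomial $h\in\mathbb R[x]$ is hyperbolic in direction $e\in\mathbb R^n$ if $h(e)\neq0$ and for every $a\in\mathbb R^n$ the polynomial $h_{a,e}(t):=h(a-te)$ has only real roots. The hyperbolicity cone is $\Lambda_e(h)=\{a\in\mathbb R^n: h_{a,e}(t)\text{ has only nonnegative roots}\}$. For $a\in\mathbb R^n$ write $a\bullet z=a_1z_1+\cdots+a_nz_n$. Let $\mathbb C\langle z\rangle=\mathbb C\langle z_1,\ldots,z_n\rangle$ be the free noncommutative unital algebra with the involution determined by $z_i^*=z_i$. Let $J_e(h)$ be the two-sided ideal generated by all $h_{a,e}(a\bullet z)$, $a\in\mathbb R^n$, together with $1-e\bullet z$, and $\mathcal A_e(h)=\mathbb C\langle z\rangle/J_e(h)$ (a unital $*$-algebra). $\Sigma^2\mathcal A_e(h)$ is the set of finite sums $\sum_i a_i^*a_i$, $a_i\in\mathcal A_e(h)$. *)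

(* Defs.v *)
From HB Require Import structures.
From mathcomp Require Import all_boot all_order all_algebra.
From mathcomp Require Import reals.
From mathcomp Require Import complex.
From mathcomp Require Import mpoly.

Set Implicit Arguments.
Unset Strict Implicit.
Unset Printing Implicit Defensive.

Import Order.TTheory GRing.Theory Num.Theory.
Local Open Scope ring_scope.

(* Real world: R : realType (the real numbers, up to isomorphism);     *)
(* complex numbers are R[i] (mathcomp-real-closed), a numClosedField.  *)
(* Vectors of R^n are functions 'I_n -> R.                             *)

Section Hyperbolic.
Variables (R : realType) (n : nat).
Local Notation C := (R[i]).

(* h_{a,e}(t) := h(a - t e), a univariate polynomial in t. *)
Definition hae (h : {mpoly R[n]}) (a e : 'I_n -> R) : {poly R} :=
  mmap (@polyC R) (fun i => (a i)%:P - (e i)%:P * 'X) h.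

(* A real univariate polynomial has only real roots: every complex root
   is real. *)
Definition only_real_roots (p : {poly R}) : Prop :=
  forall z : C, root (map_poly (fun x : R => x%:C%C) p) z -> complex.Im z = 0.

(* Only nonnegative (real) roots. *)
Definition only_nonneg_roots (p : {poly R}) : Prop :=
  forall z : C, root (map_poly (fun x : R => x%:C%C) p) z ->
    complex.Im z = 0 /\ 0 <= complex.Re z.

Definition hyperbolic (h : {mpoly R[n]}) (e : 'I_n -> R) : Prop :=
  h.@[e] != 0 /\ forall a : 'I_n -> R, only_real_roots (hae h a e).

(* Hyperbolicity cone Lambda_e(h). *)
Definition hcone (h : {mpoly R[n]}) (e : 'I_n -> R) : ('I_n -> R) -> Prop :=
  fun a => only_nonneg_roots (hae h a e).

(* Irreducibility in the polynomial ring R[x_1..x_n]: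
   a non-unit that admits only trivial factorizations. *)
Definition irreducible_mpoly (h : {mpoly R[n]}) : Prop :=
  ~~ (h \is a GRing.unit) /\
  forall f g : {mpoly R[n]}, h = f * g -> f \is a GRing.unit \/ g \is a GRing.unit.

(* The free noncommutative algebra C<z_1..z_n>.  An element is a formal *)
(* finite C-linear combination of words over the letters 'I_n, encoded  *)
(* as a list of (coefficient, word) pairs; two such lists denote the    *)
(* same element iff all their word-coefficients agree (nc_eq).          *)

Definition word := seq 'I_n.
Definition ncpoly := seq (C * word).

Definition nccoef (p : ncpoly) (w : word) : C :=
  \sum_(x <- p) (if x.2 == w then x.1 else 0).

Definition nc_eq (p q : ncpoly) : Prop := forall w, nccoef p w = nccoef q w.

Definition ncadd (p q : ncpoly) : ncpoly := p ++ q.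
Definition ncscale (c : C) (p : ncpoly) : ncpoly := [seq (c * x.1, x.2) | x <- p].
Definition ncopp (p : ncpoly) : ncpoly := ncscale (-1) p.
Definition ncmul (p q : ncpoly) : ncpoly :=
  [seq (x.1 * y.1, x.2 ++ y.2) | x <- p, y <- q].
Definition ncconst (c : C) : ncpoly := [:: (c, [::])].
Definition ncone : ncpoly := ncconst 1.
Definition ncvar (i : 'I_n) : ncpoly := [:: (1, [:: i])].
Definition ncsum (s : seq ncpoly) : ncpoly := flatten s.
Definition ncpow (p : ncpoly) (k : nat) : ncpoly := iter k (ncmul p) ncone.
(* the involution determined by z_i^* = z_i (conjugate-linear, reverses words) *)
Definition ncstar (p : ncpoly) : ncpoly :=
  [seq ((x.1)^*%C, rev x.2) | x <- p].

(* a . z = a_1 z_1 + ... + a_n z_n *)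
Definition ncdot (a : 'I_n -> R) : ncpoly :=
  [seq ((a i)%:C%C, [:: i]) | i <- enum 'I_n].

(* substitution of an nc element y into a real univariate polynomial *)
Definition nc_of_poly (p : {poly R}) (y : ncpoly) : ncpoly :=
  ncsum [seq ncscale (p`_k)%:C%C (ncpow y k) | k <- iota 0 (size p)].

(* generators of the ideal J_e(h) *)
Definition Jgen (h : {mpoly R[n]}) (e : 'I_n -> R) (g : ncpoly) : Prop :=
  (exists a : 'I_n -> R, g = nc_of_poly (hae h a e) (ncdot a))
  \/ g = ncadd ncone (ncopp (ncdot e)).

(* membership in the two-sided ideal J_e(h) generated by Jgen h e *)
Definition inJ (h : {mpoly R[n]}) (e : 'I_n -> R) (p : ncpoly) : Prop :=
  exists t : seq (ncpoly * ncpoly * ncpoly),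
    (forall x, x \in t -> Jgen h e x.1.2) /\
    nc_eq p (ncsum [seq ncmul (ncmul x.1.1 x.1.2) x.2 | x <- t]).

(* -1 is a sum of hermitian squares in A_e(h) = C<z>/J_e(h): there are
   b_1..b_k in C<z> such that the classes satisfy
   -1 = sum_i b_i^* b_i, i.e. -1 - sum_i b_i^* b_i lies in J_e(h). *)
Definition neg1_in_SOS (h : {mpoly R[n]}) (e : 'I_n -> R) : Prop :=
  exists s : seq ncpoly,
    inJ h e (ncadd (ncopp ncone) (ncopp (ncsum [seq ncmul (ncstar b) b | b <- s]))).

End Hyperbolic.

(* Hermitian and positive semidefinite complex matrices.               *)
Section Matrices.
Variable (R : realType).
Local Notation C := (R[i]).

Definition ctrmx (m k : nat) (M : 'M[C]_(m, k)) : 'M[C]_(k, m) :=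
  map_mx (fun x => (x^*)%C) M^T.

Definition hermitian_mx (m : nat) (M : 'M[C]_m) : Prop := ctrmx M = M.

Definition psd (m : nat) (M : 'M[C]_m) : Prop :=
  forall v : 'cV[C]_m, 0 <= (ctrmx v *m M *m v) 0 0.

End Matrices.

(* Main.v *)
Require Import Defs.
From HB Require Import structures.
From mathcomp Require Import all_boot all_order all_algebra finmap.
From mathcomp Require Import ring lra zify.
From mathcomp Require Import boolp classical_sets reals complex mpoly.
From mathcomp Require monalg.
Set Implicit Arguments.
Unset Strict Implicit.
Unset Printing Implicit Defensive.
Import Order.TTheory GRing.Theory Num.Theory.
Local Open Scope ring_scope.

(** Let [A] be the real free algebra and [J] the ideal generated by the
    [h_{a,e}(a.z)].  Each [h_{a,e}] is real-rooted, so [c - (a.z)^2] is a sum of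
    squares modulo [J] for large [c]; hence [1] is an order unit for the cone of
    sums of squares modulo [J], and since [-1] is not in this cone there is a
    state [phi] on [A] that vanishes on [J].  Compress the multiplications by
    the letters to the finite-dimensional Hilbert space spanned by the words of
    length at most [deg h + 1].  This gives symmetric matrices [M_j] and a
    vector [xi <> 0] with [h_{a,e}(M_a) xi = 0] for all [a], where
    [M_a = a_1 M_1 + ... + a_n M_n], because the powers of [a.z] below the degree
    applied to [1] stay in the compressed space.  If [a] is in the cone, [phi]
    restricted to the polynomials in [a.z] is supported on the nonnegative roots
    of [h_{a,e}], so [M_a] is positive semidefinite.  Conversely, read over
    [R[x]], the polynomials [h(x - t e)] and [char_poly M_x] have a common factor
    in [t]; as [R[x][t]] is factorial and [h] irreducible, [h(x - t e)] divides
    [char_poly M_x], so every root of [h_{a,e}] is an eigenvalue of [M_a]. *)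

(** * Factorial domains *)

Section FactorialDomains.

Definition divides (A : idomainType) (a b : A) := exists c, b = c * a.

Definition prime_elt (A : idomainType) (p : A) :=
  [/\ p != 0, p \isn't a GRing.unit
    & forall a b, divides p (a * b) -> divides p a \/ divides p b].

Definition factors_into (A : idomainType) (a : A) (s : seq A) :=
  (forall p, p \in s -> prime_elt p) /\
  exists2 u, u \is a GRing.unit & a = u * \prod_(p <- s) p.

(** Factors are prime rather than irreducible: such factorizations are automatically unique up to
    units, so their existence alone characterizes unique factorization domains. *)
Definition factorial_domain (A : idomainType) :=
  forall a : A, a != 0 -> exists s, factors_into a s.

Lemma divides_mull (A : idomainType) (p a b : A) : divides p b -> divides p (a * b).
Proof. by case=> c ->; exists (a * c); rewrite mulrA. Qed.

Lemma dividesD (A : idomainType) (p a b : A) :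
  divides p a -> divides p b -> divides p (a + b).
Proof. by case=> c -> [d ->]; exists (c + d); rewrite mulrDl. Qed.

Lemma prime_dividesM (A : idomainType) (p a b : A) :
  prime_elt p -> divides p (a * b) -> divides p a \/ divides p b.
Proof. by case=> _ _; apply. Qed.

Lemma prime_divides_prod (A : idomainType) (p : A) s :
  prime_elt p -> divides p (\prod_(q <- s) q) -> exists2 q, q \in s & divides p q.
Proof.
move=> [p0 pu pP]; elim: s => [|q s IH].
  rewrite big_nil => -[c /esym]; rewrite mulrC => c1.
  by case/negP: pu; apply/unitrPr; exists c.
rewrite big_cons => /pP[]; first by exists q; rewrite ?mem_head.
by case/IH=> r rs pr; exists r => //; rewrite inE rs orbT.
Qed.

Lemma prime_divides_prime (A : idomainType) (p q : A) :
  prime_elt p -> prime_elt q -> divides p q ->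
  exists2 u, u \is a GRing.unit & q = u * p.
Proof.
move=> [p0 pu pP] [q0 qu qP] [c qE]; exists c => //.
have : divides q (c * p) by exists 1; rewrite mul1r.
case/qP=> [[d cE]|[d pE]].
  case/negP: pu; apply/unitrP; exists d.
  have : q * (d * p) = q * 1 by rewrite mulr1 {2}qE cE; ring.
  by move/(mulfI q0) => dp; split=> //; rewrite mulrC.
apply/unitrP; exists d.
have : p * (d * c) = p * 1 by rewrite mulr1 {2}pE qE; ring.
by move/(mulfI p0) => dp; split=> //; rewrite mulrC.
Qed.

(** One factor in the list is associate to [p] and can be struck out. The drop in length drives the
    inner induction of [factorial_poly], applied to leading coefficients. *)
Lemma factors_into_divides (A : idomainType) (p a : A) s :
  prime_elt p -> factors_into (a * p) s ->
  exists2 s', size s = (size s').+1 & factors_into a s'.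
Proof.
move=> pp [sP [u uu aE]].
have [p0 pu pP] := pp.
have : divides p (u * \prod_(q <- s) q) by exists a.
case/pP=> [[c uE]|/(prime_divides_prod pp)[q qs]].
  by case/negP: pu; move: uu; rewrite uE unitrM => /andP[].
case/(prime_divides_prime pp (sP q qs)) => v vu qE.
exists (rem q s); first by rewrite size_rem // prednK //; case: (s) qs.
split=> [r /mem_rem /sP //|]; exists (u * v); first by rewrite unitrM uu.
apply: (mulIf p0); rewrite aE (big_rem q qs) /= {1}qE; ring.
Qed.

Lemma divides_polyC (A : idomainType) (p : A) (f : {poly A}) :
  divides p%:P f <-> forall i, divides p f`_i.
Proof.
split=> [[g ->] i|]; first by rewrite coefMC; exists g`_i.
elim/poly_ind: f => [|f c IH] H; first by exists 0; rewrite mul0r.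
have [|g ->] := IH; first by move=> i; have := H i.+1; rewrite -cons_poly_def coef_cons.
have [d cE] : divides p c by have := H 0%N; rewrite -cons_poly_def coef_cons.
by exists (g * 'X + d%:P); rewrite cE polyCM; ring.
Qed.

Lemma divides_polyC_consP (A : idomainType) (p c : A) (f : {poly A}) :
  divides p%:P (f * 'X + c%:P) <-> divides p%:P f /\ divides p c.
Proof.
rewrite !divides_polyC; split=> [H|[H1 H2] i].
  split=> [i|]; first by have := H i.+1; rewrite -cons_poly_def coef_cons.
  by have := H 0%N; rewrite -cons_poly_def coef_cons.
by rewrite -cons_poly_def coef_cons; case: i.
Qed.

(** Comparing constant terms, [p] divides one of [a], [b]. Subtracting the multiple of [p] that this
    term contributes and cancelling ['X] leaves a product in which one factor is shorter. *)
Lemma prime_polyC (A : idomainType) (p : A) : prime_elt p -> prime_elt p%:P.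
Proof.
move=> [p0 pu pP]; split; rewrite ?polyC_eq0 //.
  by rewrite poly_unitE coefC /= negb_and pu orbT.
elim/poly_ind => [|f a IHf] g; first by left; exists 0; rewrite mul0r.
elim/poly_ind: g => [|g b IHg] H; first by right; exists 0; rewrite mul0r.
have : divides p (a * b).
  have /divides_polyC/(_ 0%N) := H.
  by rewrite coef0M -!cons_poly_def !coef_cons.
case/pP=> [pa|pb].
  have : divides p%:P (f * (g * 'X + b%:P)).
    have: divides p%:P ((f * (g * 'X + b%:P)) * 'X + 0%:P).
      have -> : (f * (g * 'X + b%:P)) * 'X + 0%:P =
        (f * 'X + a%:P) * (g * 'X + b%:P) + (- (g * 'X + b%:P)) * a%:P.
        by rewrite polyC0; ring.
      apply: dividesD => //; apply: divides_mull.
      by case: pa => c ->; exists c%:P; rewrite polyCM.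
    by case/divides_polyC_consP.
  case/IHf=> [pf|]; last by right.
  by left; apply/divides_polyC_consP.
have : divides p%:P ((f * 'X + a%:P) * g).
  have: divides p%:P (((f * 'X + a%:P) * g) * 'X + 0%:P).
    have -> : ((f * 'X + a%:P) * g) * 'X + 0%:P =
      (f * 'X + a%:P) * (g * 'X + b%:P) + (- (f * 'X + a%:P)) * b%:P.
      by rewrite polyC0; ring.
    apply: dividesD => //; apply: divides_mull.
    by case: pb => c ->; exists c%:P; rewrite polyCM.
  by case/divides_polyC_consP.
case/IHg=> [|pg]; first by left.
by right; apply/divides_polyC_consP.
Qed.

Lemma polyC_unit (A : idomainType) (u : A) :
  u \is a GRing.unit -> (u%:P : {poly A}) \is a GRing.unit.
Proof. exact: rmorph_unit. Qed.

(** Gauss's lemma: each prime factor of the denominator [a] divides [v * f], hence divides [v]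
    because [f] is primitive, and can be cancelled. *)
Lemma primitive_cancel (A : idomainType) (a : A) (s : seq A) (f g v : {poly A}) :
  factors_into a s ->
  (forall p, prime_elt p -> ~ divides p%:P f) ->
  a *: g = v * f -> divides f g.
Proof.
move=> + prim; elim: s a v => [|p s IH] a v [sP [u uu aE]].
  rewrite aE big_nil mulr1 -mul_polyC => E; exists ((u^-1)%:P * v).
  by rewrite -mulrA -E mulrA -polyCM mulVr // mul1r.
have pp : prime_elt p by apply: sP; rewrite mem_head.
have p0 : p%:P != 0 :> {poly A} by rewrite polyC_eq0; case: pp.
rewrite aE big_cons => E.
have : divides p%:P (v * f).
  by exists ((u * \prod_(j <- s) j)%:P * g); rewrite -E -mul_polyC !polyCM; ring.
case/(prime_dividesM (prime_polyC pp))=> [[w vE]|/(prim _ pp) //].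
apply: (IH (u * \prod_(j <- s) j) w).
  by split=> [q qs|]; [apply: sP; rewrite inE qs orbT | exists u].
apply: (mulfI p0); transitivity (v * f); last by rewrite vE; ring.
by rewrite -E -!mul_polyC !polyCM; ring.
Qed.

(** Turns a factorization over the fraction field, with common denominator [c], into one over [A]:
    each prime factor of [c] divides [g] or [h], and removing it there keeps the degrees. *)
Lemma product_cancel (A : idomainType) (c : A) (s : seq A) (f g h : {poly A}) :
  factors_into c s -> c *: f = g * h ->
  exists g' h', [/\ f = g' * h', size g' = size g & size h' = size h].
Proof.
elim: s c g h => [|p s IH] c g h [sP [u uu cE]].
  rewrite cE big_nil mulr1 => E; exists (u^-1 *: g), h; split=> //.
    by rewrite -scalerAl -E scalerA mulVr // scale1r.
  by rewrite size_scale // invr_eq0; apply: contraTneq uu => ->; rewrite unitr0.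
have pp : prime_elt p by apply: sP; rewrite mem_head.
have p0 : p != 0 by case: pp.
have p0' : p%:P != 0 :> {poly A} by rewrite polyC_eq0.
rewrite cE big_cons => E.
have F : factors_into (u * \prod_(j <- s) j) s.
  by split=> [q qs|]; [apply: sP; rewrite inE qs orbT | exists u].
have : divides p%:P (g * h).
  by exists ((u * \prod_(j <- s) j)%:P * f); rewrite -E -mul_polyC !polyCM; ring.
case/(prime_dividesM (prime_polyC pp))=> [[w vE]|[w vE]].
  have [|g' [h' [fE sg sh]]] := IH _ w h F.
    apply: (mulfI p0'); transitivity (g * h); last by rewrite vE; ring.
    by rewrite -E -!mul_polyC !polyCM; ring.
  by exists g', h'; split=> //; rewrite vE mulrC mul_polyC size_scale.
have [|g' [h' [fE sg sh]]] := IH _ g w F.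
  apply: (mulfI p0'); transitivity (g * h); last by rewrite vE; ring.
  by rewrite -E -!mul_polyC !polyCM; ring.
by exists g', h'; split=> //; rewrite vE mulrC mul_polyC size_scale.
Qed.

(** The last hypothesis is irreducibility over the fraction field. There the gcd of [f] and [g] is
    an associate of [f] or a constant, so [f] divides a nonzero scalar multiple of [g] or, by
    coprimality, of [h]; primitivity removes the scalar. *)
Lemma primitive_irreducible_prime (A : idomainType) (f : {poly A}) :
  factorial_domain A -> (1 < size f)%N ->
  (forall p, prime_elt p -> ~ divides p%:P f) ->
  (forall c g h, c != 0 -> c *: f = g * h -> size g = 1%N \/ size h = 1%N) ->
  prime_elt f.
Proof.
move=> fA sf prim irr.
have f0 : f != 0 by rewrite -size_poly_eq0; case: size sf.
split=> //.
  by rewrite poly_unitE; case: eqP sf => // ->.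
move=> g h [q ghE].
have /Pdiv.Idomain.dvdpP[[c w] /= c0 fE] := dvdp_gcdl f g.
have /Pdiv.Idomain.dvdpP[[d v] /= d0 gE] := dvdp_gcdr f g.
case: (irr c w _ c0 fE) => [w1|r1].
  have [w0 w0n wE] : exists2 w0, w0 != 0 & w = w0%:P by apply/size_poly1P/eqP.
  have [s Fs] := fA (w0 * d) (mulf_neq0 w0n d0).
  left; apply: (primitive_cancel (v := c *: v) Fs prim).
  transitivity (v * (c *: f)); last by rewrite -!mul_polyC; ring.
  by rewrite fE wE -scalerA gE -!mul_polyC; ring.
have fg : coprimep f g by rewrite /coprimep r1.
have : f %| h.
  rewrite -(Pdiv.Idomain.Gauss_dvdpr h fg); apply/Pdiv.Idomain.dvdpP.
  by exists (1, q); rewrite ?oner_neq0 //= scale1r.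
case/Pdiv.Idomain.dvdpP=> [[b k]] /= b0 hE; right.
have [s Fs] := fA b b0.
exact: (primitive_cancel Fs prim hE).
Qed.

Lemma factors_into_unit (A : idomainType) (u : A) :
  u \is a GRing.unit -> factors_into u [::].
Proof. by move=> uu; split=> //; exists u; rewrite // big_nil mulr1. Qed.

Lemma factors_into_prime (A : idomainType) (p : A) : prime_elt p -> factors_into p [:: p].
Proof.
move=> pp; split=> [q|]; first by rewrite inE => /eqP->.
by exists 1; rewrite ?unitr1 // big_seq1 mul1r.
Qed.

Lemma factors_intoM (A : idomainType) (a b : A) s t :
  factors_into a s -> factors_into b t -> factors_into (a * b) (s ++ t).
Proof.
move=> [sP [u uu ->]] [tP [v vu ->]]; split=> [p|].
  by rewrite mem_cat => /orP[/sP|/tP].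
by exists (u * v); rewrite ?unitrM ?uu // big_cat /=; ring.
Qed.

(** Outer induction on the degree, inner induction on the number of prime factors of the leading
    coefficient. Splitting off a prime constant shortens the inner list, and a factorization over
    the fraction field lowers the degree. What remains is a unit or is prime by
    [primitive_irreducible_prime]. *)
Theorem factorial_poly (A : idomainType) : factorial_domain A -> factorial_domain {poly A}.
Proof.
move=> fA f; have [n] := ubnP (size f); elim: n f => // n IHn f.
rewrite ltnS => sf f0.
have [s] : exists s, factors_into (lead_coef f) s by apply: fA; rewrite lead_coef_eq0.
have [m] := ubnP (size s); elim: m f s sf f0 => // m IHm f s sf f0.
rewrite ltnS => sm Fs.
have [[p [pp [g fE]]]|prim] := pselect (exists p : A, prime_elt p /\ divides p%:P f).
  have p0 : p != 0 by case: pp.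
  have [s' sE Fs'] : exists2 s', size s = (size s').+1 & factors_into (lead_coef g) s'.
    by apply: (factors_into_divides pp); rewrite -[p]lead_coefC -lead_coefM -fE.
  have [|||t Ft] := IHm g s' _ _ _ Fs'.
  - by move: sf; rewrite fE mulrC mul_polyC size_scale.
  - by apply: contra_neq f0 => g0; rewrite fE g0 mul0r.
  - by rewrite sE in sm.
  exists (t ++ [:: p%:P]); rewrite fE; apply: factors_intoM => //.
  exact/factors_into_prime/prime_polyC.
have {}prim p : prime_elt p -> ~ divides p%:P f by move=> pp df; apply: prim; exists p.
have [s1|s1] := leqP (size f) 1.
  have [c c0 fE] : exists2 c, c != 0 & f = c%:P.
    by apply/size_poly1P; rewrite eqn_leq s1 lt0n size_poly_eq0.
  (* A nonzero constant that no prime divides has an empty factorization, hence is a unit. *)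
  exists [::]; apply: factors_into_unit; rewrite fE; apply: polyC_unit.
  have [[|p t] [tP [u uu cE]]] := fA c c0; first by rewrite cE big_nil mulr1.
  case: (prim p); first by apply: tP; rewrite mem_head.
  by exists (u * \prod_(j <- t) j)%:P; rewrite fE cE big_cons -polyCM; congr _%:P; ring.
have [[c [g [h [c0 E g1 h1]]]]|irr] := pselect (exists c g h,
    [/\ c != 0, c *: f = g * h, size g != 1%N & size h != 1%N]).
  have [t Ft] := fA c c0.
  have [g' [h' [fE sg sh]]] := product_cancel Ft E.
  have g0 : g' != 0 by apply: contra_neq f0 => g0; rewrite fE g0 mul0r.
  have h0 : h' != 0 by apply: contra_neq f0 => h0; rewrite fE h0 mulr0.
  have sE : (size f).+1 = (size g' + size h')%N.
    by rewrite fE size_mul // prednK // addn_gt0 lt0n size_poly_eq0 g0.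
  have : (0 < size g')%N by rewrite lt0n size_poly_eq0.
  have : (0 < size h')%N by rewrite lt0n size_poly_eq0.
  rewrite -sg in g1; rewrite -sh in h1.
  move=> gp hp.
  have [|a Fa] := IHn g' _ g0; first by lia.
  have [|b Fb] := IHn h' _ h0; first by lia.
  by exists (a ++ b); rewrite fE; apply: factors_intoM.
exists [:: f]; apply: factors_into_prime.
apply: primitive_irreducible_prime => // c g h c0 E.
have [|g1] := eqVneq (size g) 1%N; first by left.
have [|h1] := eqVneq (size h) 1%N; first by right.
by case: irr; exists c, g, h.
Qed.

Lemma divides_iso (A B : idomainType) (f : {rmorphism A -> B}) (g : B -> A) (p a : A) :
  cancel f g -> cancel g f -> divides (f p) (f a) <-> divides p a.
Proof.
move=> fK gK; split=> [[c E]|[c ->]]; last by exists (f c); rewrite rmorphM.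
by exists (g c); apply: (can_inj fK); rewrite rmorphM gK.
Qed.

Lemma prime_iso (A B : idomainType) (f : {rmorphism A -> B}) (g : B -> A) (p : A) :
  cancel f g -> cancel g f -> prime_elt p -> prime_elt (f p).
Proof.
move=> fK gK [p0 pu pP]; have fI := can_inj fK; split.
- by rewrite raddf_eq0.
- apply: contra pu => /unitrP[c [E1 E2]]; apply/unitrP; exists (g c).
  by split; apply: fI; rewrite rmorphM gK rmorph1.
move=> a b; rewrite -[a]gK -[b]gK -rmorphM !(divides_iso _ _ fK gK).
exact: pP.
Qed.

Lemma factorial_iso (A B : idomainType) (f : {rmorphism A -> B}) (g : {rmorphism B -> A}) :
  cancel f g -> cancel g f -> factorial_domain A -> factorial_domain B.
Proof.
move=> fK gK fA b b0.
have [|s [sP [u uu E]]] := fA (g b); first by rewrite raddf_eq0 //; apply: can_inj gK.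
exists (map f s); split=> [_ /mapP[q qs ->]|]; first exact: prime_iso fK gK (sP q qs).
by exists (f u); rewrite ?rmorph_unit // -[b]gK E rmorphM rmorph_prod big_map.
Qed.

Lemma irreducible_prime (A : idomainType) (a : A) : factorial_domain A -> a != 0 ->
  a \isn't a GRing.unit ->
  (forall f g, a = f * g -> f \is a GRing.unit \/ g \is a GRing.unit) -> prime_elt a.
Proof.
move=> fA a0 au irr; have [[|p s] [sP [u uu aE]]] := fA a a0.
  by case/negP: au; rewrite aE big_nil mulr1.
have [p0 pu pP] : prime_elt p by apply: sP; rewrite mem_head.
have {}aE : a = (u * \prod_(q <- s) q) * p by rewrite aE big_cons; ring.
have [vu|] := irr _ _ aE; last by move=> pu'; rewrite pu' in pu.
move: vu aE; set v := u * _ => vu aE.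
have aP x : divides a x <-> divides p x.
  split=> -[c ->]; first by rewrite aE; exists (c * v); rewrite mulrA.
  by exists (c * v^-1); rewrite aE mulrA mulrVK.
by split=> // x y; rewrite !aP; apply: pP.
Qed.

End FactorialDomains.

(** * Multivariate polynomials *)

Section MultivariatePolynomials.

Lemma mpoly_rmorph_eq (n : nat) (A S : comNzRingType) (f g : {rmorphism {mpoly A[n]} -> S}) :
  (forall c, f c%:MP = g c%:MP) -> (forall i, f 'X_i = g 'X_i) -> f =1 g.
Proof.
move=> fgC fgX p; rewrite [p]mpolyE !rmorph_sum; apply: eq_bigr => m _.
rewrite -mul_mpolyC rmorphM [RHS]rmorphM fgC mpolyXE_id !rmorph_prod; congr (_ * _).
by apply: eq_bigr => i _; rewrite !rmorphXn /= fgX.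
Qed.

(** * Multivariate polynomials as iterated univariate polynomials *)

Section Iteration.
Variables (n : nat) (F : comNzRingType).

(** The inverse of [muni]: the univariate variable becomes the last indeterminate. This isomorphism
    lets factoriality pass from [n] to [n.+1] variables. *)
Definition mpoly_of_poly : {poly {mpoly F[n]}} -> {mpoly F[n.+1]} :=
  horner_eval 'X_ord_max \o map_poly (@mwiden n F).
HB.instance Definition _ := GRing.RMorphism.on mpoly_of_poly.

Local Notation widen := (widen_ord (leqnSn n)).

Lemma mpoly_of_polyC c : mpoly_of_poly c%:P = mwiden c.
Proof. by rewrite /mpoly_of_poly /= map_polyC /= horner_evalE hornerC. Qed.

Lemma mpoly_of_polyX : mpoly_of_poly 'X = 'X_ord_max.
Proof. by rewrite /mpoly_of_poly /= map_polyX horner_evalE hornerX. Qed.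

Lemma muniX_max : muni 'X_ord_max = 'X :> {poly {mpoly F[n]}}.
Proof.
rewrite /muni mmapX mmap1U; case: splitP => // j /= E.
by have := ltn_ord j; rewrite -E ltnn.
Qed.

Lemma muniX_widen i : muni 'X_(widen i) = ('X_i)%:P :> {poly {mpoly F[n]}}.
Proof.
rewrite /muni mmapX mmap1U; case: splitP => j /= E.
  by congr ('X__)%:P; apply/val_inj.
by have := ltn_ord i; rewrite E ord1 addn0 ltnn.
Qed.

Lemma mwiden_XU i : mwiden 'X_i = 'X_(widen i) :> {mpoly F[n.+1]}.
Proof. by rewrite mwidenX mnmwiden1. Qed.

Lemma muni_mwiden c : muni (mwiden c) = c%:P :> {poly {mpoly F[n]}}.
Proof.
apply: (@mpoly_rmorph_eq n F _ (@muni n F \o @mwiden n F) polyC) => [a|i] /=.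
  by rewrite mwidenC muniC.
by rewrite mwiden_XU muniX_widen.
Qed.

Lemma mpoly_of_polyK : cancel mpoly_of_poly (@muni n F).
Proof.
elim/poly_ind=> [|p c IH]; first by rewrite !rmorph0.
by rewrite !rmorphD !rmorphM /= mpoly_of_polyC mpoly_of_polyX muniX_max IH muni_mwiden.
Qed.

Lemma ord_max_or_widen (i : 'I_n.+1) : i = ord_max \/ exists j, i = widen j.
Proof.
have [in_|] := ltnP i n; first by right; exists (Ordinal in_); apply/val_inj.
by move=> ni; left; apply/val_inj/eqP; rewrite /= eqn_leq ni -ltnS ltn_ord.
Qed.

Lemma muniK : cancel (@muni n F) mpoly_of_poly.
Proof.
apply: (@mpoly_rmorph_eq n.+1 F _ (mpoly_of_poly \o @muni n F) idfun) => [a|i] /=.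
  by rewrite muniC mpoly_of_polyC mwidenC.
have [->|[j ->]] := ord_max_or_widen i; first by rewrite muniX_max mpoly_of_polyX.
by rewrite muniX_widen mpoly_of_polyC mwiden_XU.
Qed.

End Iteration.

Lemma factorial_mpoly (F : fieldType) n : factorial_domain {mpoly F[n]}.
Proof.
elim: n => [|n IH].
  move=> p p0; exists [::]; apply: factors_into_unit.
  have pE : p = (p@_0)%:MP by rewrite -[LHS]mpolyKC.
  rewrite pE; apply: rmorph_unit; rewrite unitfE.
  by apply: contraNneq p0 => E; rewrite pE E mpolyC0.
exact: factorial_iso (@mpoly_of_polyK n F) (@muniK n F) (factorial_poly IH).
Qed.

(** * Polynomials that vanish at every point *)

Lemma poly_horner_eq0 (F : numDomainType) (p : {poly F}) :
  (forall x, p.[x] = 0) -> p = 0.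
Proof.
move=> p0; apply/eqP; apply: contraT => pn0.
have := max_poly_roots (rs := [seq (i%:R : F) | i <- iota 0 (size p)]) pn0.
rewrite size_map size_iota ltnn => ->//.
  by apply/allP => x _; rewrite rootE p0.
by rewrite map_inj_uniq ?iota_uniq // => i j /eqP; rewrite eqr_nat => /eqP.
Qed.

Lemma meval_mwiden (F : comNzRingType) n (x : 'I_n.+1 -> F) (p : {mpoly F[n]}) :
  (mwiden p).@[x] = p.@[x \o widen_ord (leqnSn n)].
Proof.
apply: (@mpoly_rmorph_eq n F _ (meval x \o @mwiden n F) (meval (x \o widen_ord (leqnSn n)))).
  by move=> c /=; rewrite mwidenC !mevalC.
by move=> i /=; rewrite mwiden_XU !mevalXU.
Qed.

(** Serves to lift the matrix identity known at every real point to one with indeterminate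
    entries. *)
Lemma mpoly_meval_eq0 (F : numDomainType) n (p : {mpoly F[n]}) :
  (forall x, p.@[x] = 0) -> p = 0.
Proof.
elim: n p => [|n IH] p p0.
  by rewrite -[p]mpolyKC; have := p0 (fun=> 0); rewrite -[p]mpolyKC mevalC mpolyKC => ->; rewrite mpolyC0.
rewrite -[p]muniK; suff -> : muni p = 0 by rewrite rmorph0.
apply/polyP => k; rewrite coef0; apply: IH => x.
suff : map_poly (meval x) (muni p) = 0.
  by move/(congr1 (fun q : {poly F} => q`_k)); rewrite coef_map coef0.
apply: poly_horner_eq0 => t.
pose y (i : 'I_n.+1) := if insub (val i) is Some j then x j else t.
rewrite -[RHS](p0 y) -[in RHS](muniK p).
rewrite /mpoly_of_poly /= horner_evalE -horner_map /= mevalXU -map_poly_comp /=.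
have -> : y ord_max = t by rewrite /y insubN // ltnn.
congr (_.[_]); apply: eq_map_poly => c /=.
rewrite meval_mwiden; apply: meval_eq => i /=.
by rewrite /y; case: insubP => [j _ E|/=]; [congr x; apply/val_inj | rewrite ltn_ord].
Qed.

End MultivariatePolynomials.

(** * Real-rooted polynomials *)

Section RealRootedPolynomials.
Variable R : realType.
Local Notation C := (R[i]).
Implicit Types p q u : {poly R}.

Lemma only_real_roots_neq0 p : only_real_roots p -> p != 0.
Proof.
move=> pr; apply: contraT => /negPn/eqP p0.
have /pr /= : root (map_poly (fun x : R => x%:C%C) p) 'i%C by rewrite p0 map_poly0 root0.
by move/eqP; rewrite oner_eq0.
Qed.

Lemma only_nonneg_real_roots p : only_nonneg_roots p -> only_real_roots p.
Proof. by move=> pr z /pr[]. Qed.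

Lemma real_rooted_split p : only_real_roots p -> exists rs : seq R,
  p = lead_coef p *: \prod_(r <- rs) ('X - r%:P) /\
  (forall r, r \in rs -> root (map_poly (fun x : R => x%:C%C) p) r%:C%C).
Proof.
move=> pr; set f := (fun x : R => x%:C%C).
have [zs zsE] := closed_field_poly_normal (map_poly (real_complex R) p).
have pz z : z \in zs -> root (map_poly f p) z.
  move=> zz; rewrite [X in root X _]zsE rootZ ?root_prod_XsubC //.
  by rewrite lead_coef_map fmorph_eq0 lead_coef_eq0 only_real_roots_neq0.
have zRe z : z \in zs -> z = (complex.Re z)%:C%C.
  by move/pz/pr; case: z => a b /= ->.
exists (map (@complex.Re R) zs); split; last first.
  by move=> _ /mapP[z zz ->]; rewrite -zRe //; apply: pz.
apply: (map_poly_inj (real_complex R)).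
rewrite [LHS]zsE map_polyZ rmorph_prod /= lead_coef_map; congr (_ *: _).
rewrite big_map big_seq [RHS]big_seq; apply: eq_bigr => z /zRe zE.
by rewrite map_polyXsubC /= -zE.
Qed.

Definition sos_mod (f p : {poly R}) :=
  exists s u, p = \sum_(q <- s) q ^+ 2 + u * f.

Lemma sos_modD f p q : sos_mod f p -> sos_mod f q -> sos_mod f (p + q).
Proof.
by move=> [s [u ->]] [t [v ->]]; exists (s ++ t), (u + v); rewrite big_cat /=; ring.
Qed.

Lemma sos_mod_sqr f p : sos_mod f (p ^+ 2).
Proof. by exists [:: p], 0; rewrite big_seq1 mul0r addr0. Qed.

Lemma sos_modZ f (c : R) p : 0 <= c -> sos_mod f p -> sos_mod f (c *: p).
Proof.
move=> c0 [s [u ->]]; exists [seq Num.sqrt c *: q | q <- s], (c *: u).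
rewrite big_map scalerDr scalerAl scaler_sumr; congr (_ + _).
by apply: eq_bigr => q _; rewrite exprZn sqr_sqrtr.
Qed.

Lemma sos_mod_mul_sqr f g p : sos_mod f p -> sos_mod (g * f) (g ^+ 2 * p).
Proof.
move=> [s [u ->]]; exists [seq g * q | q <- s], (u * g).
rewrite big_map mulrDr mulr_sumr; congr (_ + _); last by ring.
by apply: eq_bigr => q _; rewrite exprMn.
Qed.

Lemma sos_mod_mulr f g p : sos_mod f p -> (exists u, f = u * g) -> sos_mod g p.
Proof. by move=> [s [u ->]] [v ->]; exists s, (u * v); rewrite mulrA. Qed.

(* With [y = X - r] and [c] large, [y^2 (c - y^2)] is a sum of squares modulo
   [(X - r) f] as soon as [c - y^2] is one modulo [f], and
   [c (c - y^2) = (y^2 - c)^2 + y^2 (c - y^2)]. *)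
Lemma sos_mod_bound (rs : seq R) : exists2 c : R, 0 < c &
  sos_mod (\prod_(r <- rs) ('X - r%:P)) (c%:P - 'X ^+ 2).
Proof.
elim: rs => [|r rs [c c0 IH]].
  by exists 1 => //; exists [::], (1%:P - 'X ^+ 2); rewrite !big_nil; ring.
set f := \prod_(r <- rs) _ in IH; pose y : {poly R} := 'X - r%:P.
pose c1 := 2 * c + 2 * r ^+ 2.
have c10 : 0 < c1 by rewrite /c1; have := sqr_ge0 r; lra.
have H1 : sos_mod f (c1%:P - y ^+ 2).
  have -> : c1%:P - y ^+ 2 = 2 *: (c%:P - 'X ^+ 2) + ('X + r%:P) ^+ 2.
    by rewrite -mul_polyC /c1 /y !(polyCD, polyCM, polyC_exp); ring.
  by apply: sos_modD; [apply: sos_modZ | apply: sos_mod_sqr].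
have H2 : sos_mod (y * f) (c1%:P - y ^+ 2).
  have -> : c1%:P - y ^+ 2 = c1^-1 *: ((y ^+ 2 - c1%:P) ^+ 2 + y ^+ 2 * (c1%:P - y ^+ 2)).
    have -> : (y ^+ 2 - c1%:P) ^+ 2 + y ^+ 2 * (c1%:P - y ^+ 2) = c1 *: (c1%:P - y ^+ 2).
      by rewrite -mul_polyC; ring.
    by rewrite scalerA mulVf ?scale1r // gt_eqF.
  apply: sos_modZ; first by rewrite invr_ge0 ltW.
  by apply: sos_modD; [apply: sos_mod_sqr | apply: sos_mod_mul_sqr].
exists (2 * c1 + 2 * r ^+ 2); first by have := sqr_ge0 r; lra.
rewrite big_cons -/f -/y.
have -> : (2 * c1 + 2 * r ^+ 2)%:P - 'X ^+ 2 = 2 *: (c1%:P - y ^+ 2) + (y - r%:P) ^+ 2.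
  by rewrite -mul_polyC /y !(polyCD, polyCM, polyC_exp); ring.
by apply: sos_modD; [apply: sos_modZ | apply: sos_mod_sqr].
Qed.

Lemma real_rooted_bound p : only_real_roots p ->
  exists2 c : R, 0 < c & sos_mod p (c%:P - 'X ^+ 2).
Proof.
move=> pr; have [rs [pE _]] := real_rooted_split pr.
have [c c0 Hc] := sos_mod_bound rs; exists c => //.
apply: (sos_mod_mulr Hc); exists ((lead_coef p)^-1)%:P.
rewrite {2}pE mul_polyC scalerA mulVf ?scale1r //.
by rewrite lead_coef_eq0 only_real_roots_neq0.
Qed.

Lemma affine_ge0_eq0 (a b : R) : (forall t, 0 <= a + t * b) -> b = 0.
Proof.
move=> H; apply/eqP; apply: contraT => b0.
(* At this [t] the affine function takes the value -1. *)
by have := H (- (a + 1) / b); rewrite mulfVK //; lra.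
Qed.

(** * Positive functionals on univariate polynomials *)

Section PositiveFunctional.
Variable L : {poly R} -> R.
Hypotheses (LD : forall p q, L (p + q) = L p + L q) (LZ : forall c p, L (c *: p) = c * L p).
Hypothesis L_sqr : forall p, 0 <= L (p ^+ 2).

Lemma functional_sum (T : Type) (s : seq T) (F : T -> {poly R}) :
  L (\sum_(x <- s) F x) = \sum_(x <- s) L (F x).
Proof.
elim: s => [|x s IH]; first by rewrite !big_nil -[0 in LHS](scale0r 0) LZ mul0r.
by rewrite !big_cons LD IH.
Qed.

(** Degenerate Cauchy-Schwarz: positivity on [(q + t *: p) ^+ 2] leaves an affine function of [t]
    that is nowhere negative. *)
Lemma functional_null p q : L (p ^+ 2) = 0 -> L (p * q) = 0.
Proof.
move=> p0; suff : 2 * L (p * q) = 0 by lra.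
apply: (@affine_ge0_eq0 (L (q ^+ 2))) => t.
have := L_sqr (q + t *: p); have -> : (q + t *: p) ^+ 2 =
    q ^+ 2 + ((2 * t) *: (p * q) + t ^+ 2 *: (p ^+ 2)).
  by rewrite -!mul_polyC polyCM polyC_exp; ring.
by rewrite !LD !LZ p0; lra.
Qed.

(** The square of [g ^+ m.+1] is a multiple of [g ^+ m.+2], so [functional_null] lowers the exponent
    by one at a time. *)
Lemma functional_null_radical g m :
  (forall u, L (g ^+ m.+1 * u) = 0) -> forall u, L (g * u) = 0.
Proof.
elim: m => [|m IH] H u; first by have := H u; rewrite expr1.
apply: IH => v; apply: functional_null.
by rewrite -exprM (_ : (m.+1 * 2 = m.+2 + m)%N) ?exprD //; lia.
Qed.

(** By positivity [L] kills not only the multiples of [p] but those of its squarefree part [g], so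
    it sees only values at the distinct roots. There ['X * q ^+ 2] agrees with a combination of
    squares whose weights are the roots, which are nonnegative. *)
Lemma functional_X_ge0 p q : only_nonneg_roots p ->
  (forall u, L (p * u) = 0) -> 0 <= L ('X * q ^+ 2).
Proof.
move=> pr Lp; have pr' := only_nonneg_real_roots pr.
have [rs [pE rsP]] := real_rooted_split pr'.
have rs0 r : r \in rs -> 0 <= r by move/rsP/pr => -[].
pose s := undup rs; pose g : {poly R} := \prod_(r <- s) ('X - r%:P).
have Lg u : L (g * u) = 0.
  apply: (@functional_null_radical g (size rs)) => v.
  (* Each of the [size rs] linear factors of [p] divides [g]; the extra factor matches the exponent
     in [functional_null_radical]. *)
  have : p %| g ^+ (size rs).+1.
    rewrite pE dvdpZl ?lead_coef_eq0 ?only_real_roots_neq0 // exprS dvdp_mull //.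
    have : {subset rs <= s} by move=> r; rewrite mem_undup.
    elim: (rs) => [|r t IH] ts; first by rewrite big_nil dvd1p.
    rewrite big_cons /= exprS dvdp_mul ?IH //; last first.
      by move=> x xt; apply: ts; rewrite inE xt orbT.
    by rewrite dvdp_XsubCl root_prod_XsubC ts // mem_head.
  by case/dvdpP => w ->; rewrite [w * p]mulrC -mulrA Lp.
have Lroots u : (forall r, r \in s -> root u r) -> L u = 0.
  move=> us; have : g %| u.
    by apply: uniq_roots_dvdp; [apply/allP | rewrite uniq_rootsE undup_uniq].
  by case/dvdpP => w ->; rewrite mulrC.
(* The Lagrange basis at the distinct roots. *)
pose l r : {poly R} := \prod_(t <- s | t != r) ((r - t)^-1 *: ('X - t%:P)).
have lE r t : r \in s -> t \in s -> (l r).[t] = (t == r)%:R.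
  move=> rs' ts; rewrite /l horner_prod; case: eqP => [->|/eqP tr].
    rewrite big1 // => x xr; rewrite hornerZ hornerXsubC mulVf //.
    by rewrite subr_eq0 eq_sym.
  by rewrite (big_rem t) //= tr hornerZ hornerXsubC subrr mulr0 mul0r.
have : L ('X * q ^+ 2 - \sum_(r <- s) r *: (q * l r) ^+ 2) = 0.
  apply: Lroots => t ts; rewrite rootE hornerD hornerN horner_sum.
  rewrite (bigD1_seq t) ?undup_uniq //= big_seq_cond big1 => [|r /andP[rs' rt]].
    by rewrite !hornerE /= lE // eqxx !mulr1 subrr.
  by rewrite !hornerE /= lE // eq_sym (negbTE rt) !(mulr0, mul0r).
move/eqP; rewrite LD -scaleN1r LZ mulN1r subr_eq0 => /eqP->.
rewrite functional_sum big_seq; apply: sumr_ge0 => r; rewrite mem_undup => /rs0 r0.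
by rewrite LZ mulr_ge0.
Qed.

End PositiveFunctional.
End RealRootedPolynomials.

(** * Separation from a convex cone *)

Section ConeSeparation.
Local Open Scope classical_set_scope.
Variables (R : realType) (E : lmodType R) (u : E).
Implicit Types (P Q : set E) (x y : E).

Definition convex_cone P :=
  [/\ P 0, forall x y, P x -> P y -> P (x + y)
    & forall (c : R) x, 0 <= c -> P x -> P (c *: x)].

Definition order_unit P := P u /\ forall x, exists c, P (c *: u - x).

(** Zorn gives a maximal cone avoiding [- u]. If it contained neither [x] nor [- x], adjoining
    either would produce [- u], and the positive combination of the two expressions in which [x]
    cancels would already put [- u] in the cone. *)
Lemma maximal_cone P : convex_cone P -> ~ P (- u) ->
  exists Q, [/\ convex_cone Q, ~ Q (- u), P `<=` Q & forall x, Q x \/ Q (- x)].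
Proof.
move=> coneP Pu.
(* Joining [P] inside the predicate makes the empty chain harmless: its union is empty and the
   resulting cone is [P]. *)
pose good B := convex_cone (P `|` B) /\ ~ (P `|` B) (- u).
have [F Fgood Ftot|B [[coneB Bu] Bmax]] := @Zorn_bigcup E good.
  split; last first.
    move=> [//|[B FB Bu]]; have [_] := Fgood B FB; apply; by right.
  have [P0 PD PZ] := coneP.
  have up x y : (P `|` \bigcup_(B in F) B) x -> (P `|` \bigcup_(B in F) B) y ->
      exists B, [/\ good B, B `<=` \bigcup_(B in F) B, (P `|` B) x & (P `|` B) y].
    move=> [Px|[B FB Bx]] [Py|[D FD Dy]].
    - exists set0; split; [|by []|by left|by left].
      by rewrite /good setU0.
    - by exists D; split; [exact: Fgood|move=> z Dz; exists D|left|right].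
    - by exists B; split; [exact: Fgood|move=> z Bz; exists B|right|left].
    - have [BD|DB] := Ftot _ _ FB FD.
        by exists D; split; [exact: Fgood|move=> z Dz; exists D|right; exact: BD|right].
      by exists B; split; [exact: Fgood|move=> z Bz; exists B|right|right; exact: DB].
  have back B : B `<=` \bigcup_(B in F) B -> P `|` B `<=` P `|` \bigcup_(B in F) B.
    by move=> BF; apply: setUS.
  split; first by left.
    move=> x y Hx Hy; have [B [[[_ BD _] _] BF Bx By]] := up _ _ Hx Hy.
    by apply: (back B BF); apply: BD.
  move=> c x c0 Hx; have [B [[[_ _ BZ] _] BF Bx _]] := up _ _ Hx Hx.
  by apply: (back B BF); apply: BZ.
pose Q := P `|` B; rewrite -/Q in coneB Bu; have [Q0 QD QZ] := coneB.
(* By maximality the cone spanned by [Q] and [x] contains [- u]; the coefficient [a] is nonzero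
   because [Q] does not contain it. *)
have add x : ~ Q x -> exists q a, [/\ Q q, 0 < a & - u = q + a *: x].
  move=> nQx; pose D := [set z | exists q a, [/\ Q q, 0 <= a & z = q + a *: x]].
  have QS : Q `<=` D by move=> z Qz; exists z, 0; rewrite scale0r addr0.
  have PDD : P `|` D = D by apply/seteqP; split=> z; [case=> // Pz; apply: QS; left|right].
  have BD : B `<` D.
    split; first by move=> z Bz; apply: QS; right.
    move=> DB; apply: nQx; right; apply: DB.
    by exists 0, 1; rewrite scale1r add0r ler01.
  have := Bmax D BD; rewrite /good PDD => /not_andP[]; last first.
    move/contrapT => -[q [a [Qq a0 uE]]]; exists q, a; split=> //.
    rewrite lt_neqAle a0 andbT; apply/eqP => a00; apply: Bu.
    by rewrite uE -a00 scale0r addr0.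
  case; split; first exact: QS.
    move=> _ _ [q [a [Qq a0 ->]]] [r [b [Qr b0 ->]]]; exists (q + r), (a + b).
    by split; [exact: QD|exact: addr_ge0|rewrite scalerDl addrACA].
  move=> c _ c0 [q [a [Qq a0 ->]]]; exists (c *: q), (c * a).
  by split; [exact: QZ|exact: mulr_ge0|rewrite scalerDr scalerA].
exists Q; split=> //; first by move=> x Px; left.
move=> x; have [|/add[q [a [Qq a0 qE]]]] := pselect (Q x); first by left.
have [|/add[r [b [Qr b0 rE]]]] := pselect (Q (- x)); first by right.
case: Bu; have ab : a + b != 0 by rewrite gt_eqF // addr_gt0.
have -> : - u = (a + b)^-1 *: (b *: q + a *: r).
  have -> : b *: q + a *: r = (a + b) *: (- u).
    rewrite scalerDl {1}rE qE !scalerDr !scalerA scalerN [b * a]mulrC.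
    by rewrite [RHS]addrACA addNr addr0 addrC.
  by rewrite scalerA mulVf // scale1r.
by apply: (QZ); [rewrite invr_ge0 ltW // addr_gt0 | apply: QD; apply: QZ => //; exact: ltW].
Qed.

(* The functional sends [x] to the largest [c] such that [x - c u] lies in a
   maximal cone that contains [P] but not [- u]. *)
Lemma positive_functional P : convex_cone P -> order_unit P -> ~ P (- u) ->
  exists f : E -> R, [/\ forall x y, f (x + y) = f x + f y,
    forall c x, f (c *: x) = c * f x, f u = 1 & forall x, P x -> 0 <= f x].
Proof.
move=> coneP [Pu unitP] nPu.
have [Q [[Q0 QD QZ] Qu PQ Qtot]] := maximal_cone coneP nPu.
pose V x := [set c : R | Q (x - c *: u)].
have QuE c : 0 <= c -> Q (c *: u) by move=> c0; apply: QZ => //; apply: PQ.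
have Qneg c : c < 0 -> ~ Q (c *: u).
  move=> c0 Qc; apply: Qu; have -> : - u = (- c^-1) *: (c *: u).
    by rewrite scalerA mulNr mulVf ?scaleN1r // lt_eqF.
  by apply: QZ => //; rewrite oppr_ge0 invr_le0 ltW.
have VP x : has_sup (V x).
  split.
    have [c Pc] := unitP (- x); exists (- c).
    by rewrite /V /= scaleNr opprK addrC; apply: PQ; rewrite -[x]opprK.
  have [c Pc] := unitP x; exists c => d /= Vd; rewrite leNgt; apply/negP => cd.
  apply: (Qneg (c - d)); first by rewrite subr_lt0.
  have -> : (c - d) *: u = (c *: u - x) + (x - d *: u) by rewrite scalerBl addrA subrK.
  by apply: QD => //; apply: PQ.
pose f x := sup (V x).
(* This squeeze criterion and its converse [fP] reduce linearity of [f] to membership in [Q] up to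
   an arbitrarily small slack [d]. *)
have fE x c : (forall d, 0 < d -> Q (x - (c - d) *: u) /\ Q ((c + d) *: u - x)) -> f x = c.
  move=> H; apply/eqP; rewrite eq_le; apply/andP; split; last first.
    apply/ler_addgt0Pr => d d0; rewrite -lerBlDr.
    by apply: ub_le_sup; [case: (VP x)|have [] := H d d0].
  apply: ge_sup; first by case: (VP x).
  move=> d /= Vd; rewrite leNgt; apply/negP => cd.
  have dp : 0 < (d - c) / 2 by lra.
  apply: (Qneg ((c + (d - c) / 2) - d)); first by lra.
  have -> : (c + (d - c) / 2 - d) *: u =
      ((c + (d - c) / 2) *: u - x) + (x - d *: u) by rewrite addrA subrK -scalerBl.
  by apply: QD => //; have [] := H _ dp.
have fP x d : 0 < d -> Q (x - (f x - d) *: u) /\ Q ((f x + d) *: u - x).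
  move=> d0; split.
    have [c Vc cf] := sup_adherent d0 (VP x).
    have -> : x - (f x - d) *: u = (x - c *: u) + (c - (f x - d)) *: u.
      by rewrite [(c - _) *: u]scalerBl addrA subrK.
    by apply: QD => //; apply: QuE; rewrite subr_ge0 ltW.
  (* The other alternative of totality would make [f x + d] an element of [V x] above its
     supremum. *)
  have [|] := Qtot ((f x + d) *: u - x) => //; rewrite opprB => H.
  have : f x + d <= f x by apply: ub_le_sup => //; case: (VP x).
  by rewrite gerDl leNgt d0.
exists f; split.
- move=> x y; apply: fE => d d0; have d2 : 0 < d / 2 by lra.
  have [X1 X2] := fP x _ d2; have [Y1 Y2] := fP y _ d2; split.
    have -> : x + y - (f x + f y - d) *: u =
        (x - (f x - d / 2) *: u) + (y - (f y - d / 2) *: u); last exact: QD.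
      by rewrite addrACA -opprD -scalerDl; congr (_ - _ *: _); lra.
  have -> : (f x + f y + d) *: u - (x + y) =
      ((f x + d / 2) *: u - x) + ((f y + d / 2) *: u - y); last exact: QD.
    by rewrite addrACA -opprD -scalerDl; congr (_ *: _ - _); lra.
- have fZ c x : 0 < c -> f (c *: x) = c * f x.
    move=> c0; apply: fE => d d0; have dc : 0 < d / c by rewrite divr_gt0.
    have dE : d = c * (d / c) by rewrite mulrC divfK // gt_eqF.
    have [X1 X2] := fP x _ dc; split.
      have -> : c *: x - (c * f x - d) *: u = c *: (x - (f x - d / c) *: u).
        by rewrite scalerBr scalerA mulrBr -dE.
      by apply: QZ => //; apply: ltW.
    have -> : (c * f x + d) *: u - c *: x = c *: ((f x + d / c) *: u - x).
      by rewrite scalerBr scalerA mulrDr -dE.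
    by apply: QZ => //; apply: ltW.
  have fN x : f (- x) = - f x.
    apply: fE => d d0; have [X1 X2] := fP x _ d0; split.
      have -> // : - x - (- f x - d) *: u = (f x + d) *: u - x.
      by rewrite -[- f x - d]opprD scaleNr opprK addrC.
    have -> // : (- f x + d) *: u - (- x) = x - (f x - d) *: u.
    by rewrite opprK addrC -scaleNr opprB [d - _]addrC.
  move=> c x; have [c0|c0|->] := ltgtP c 0; last 2 first.
  + exact: fZ.
  + rewrite scale0r mul0r; apply: fE => d d0; rewrite !sub0r add0r scaleNr opprK subr0.
    by split; apply: QuE; apply: ltW.
  have := fZ (- c) x; rewrite oppr_gt0 scaleNr fN mulNr => /(_ c0); exact: oppr_inj.
- apply: fE => d d0; rewrite scalerBl scalerDl scale1r subKr addrC addKr.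
  by split; apply: QuE; apply: ltW.
move=> x /PQ Qx; apply: ub_le_sup; first by case: (VP x).
by rewrite /V /= scale0r subr0.
Qed.

End ConeSeparation.

(** * States on star-algebras and their compressions *)

Section StarAlgebra.
Variables (R : realType) (A : algType R) (star : A -> A).
Hypotheses (starD : forall x y, star (x + y) = star x + star y)
  (starZ : forall (c : R) x, star (c *: x) = c *: star x)
  (starM : forall x y, star (x * y) = star y * star x)
  (starK : forall x, star (star x) = x).
Implicit Types x y z q : A.

Lemma star_algebra0 : star 0 = 0.
Proof. by rewrite -[0 in LHS](scale0r (0 : A)) starZ scale0r. Qed.

Lemma star_algebraN x : star (- x) = - star x.
Proof. by rewrite -scaleN1r starZ scaleN1r. Qed.

Lemma star_algebra1 : star 1 = 1.
Proof. by rewrite -[LHS]mul1r -{1}[1]starK -starM mul1r starK. Qed.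

Lemma star_algebra_sum (T : Type) (s : seq T) (F : T -> A) :
  star (\sum_(i <- s) F i) = \sum_(i <- s) star (F i).
Proof. exact: (big_morph star starD star_algebra0). Qed.

(** * Existence of a state *)

Section States.
Variable S : A -> Prop.
Hypotheses (S_add : forall x y, S x -> S y -> S (x + y))
  (S_scale : forall (c : R) x, 0 <= c -> S x -> S (c *: x))
  (S_sqr : forall x, S (star x * x))
  (S_conj : forall q x, S x -> S (star q * x * q))
  (S_star : forall x, S x -> S (star x))
  (S_proper : ~ S (-1)).

Definition bounded x := exists2 c : R, 0 <= c & S (c%:A - star x * x).

(** This extends the cone from selfadjoint elements to the whole algebra. It contains [x - star x]
    and its negative, so a functional nonnegative on it is automatically invariant under [star]. *)
Definition real_part_in x := S (x + star x).

Lemma real_part_inD x y : real_part_in x -> real_part_in y -> real_part_in (x + y).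
Proof. by move=> Px Py; rewrite /real_part_in starD addrACA; apply: S_add. Qed.

Lemma bounded1 : bounded 1.
Proof.
exists 1; rewrite ?ler01 // star_algebra1 mulr1 scale1r subrr.
by rewrite -(scale0r (star 1 * 1)); apply: S_scale.
Qed.

Lemma bounded_mul x y : bounded x -> bounded y -> bounded (x * y).
Proof.
move=> [c c0 Sc] [d d0 Sd]; exists (c * d); first exact: mulr_ge0.
have -> : (c * d)%:A - star (x * y) * (x * y) =
    star y * (c%:A - star x * x) * y + c *: (d%:A - star y * y).
  rewrite starM mulrBr mulrBl -scalerAr mulr1 -scalerAl scalerBr scalerA.
  by rewrite [RHS]addrC [RHS]addrA subrK !mulrA.
by apply: S_add; [apply: S_conj | apply: S_scale].
Qed.

Lemma bounded_scale_unit (a : R) x : bounded x ->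
  exists c : R, real_part_in (c%:A - a *: x).
Proof.
(* Adding the square of [1 - a *: x] to [a ^+ 2] times the bound on [x] cancels the quadratic terms
   and leaves the scalar [1 + a ^+ 2 * b]; it is halved because [real_part_in] doubles scalars. *)
move=> [b b0 Sb]; exists ((1 + a ^+ 2 * b) / 2); rewrite /real_part_in.
have -> : ((1 + a ^+ 2 * b) / 2)%:A - a *: x + star (((1 + a ^+ 2 * b) / 2)%:A - a *: x) =
    star (1 - a *: x) * (1 - a *: x) + a ^+ 2 *: (b%:A - star x * x).
  rewrite !starD !star_algebraN !starZ star_algebra1 addrACA -scalerDl -splitr.
  rewrite mulrBr mulr1 mulrBl mul1r scalerBr scalerA scalerDl scale1r.
  rewrite -scalerAl -scalerAr scalerA -expr2 opprB.
  rewrite -[RHS]addrA [a ^+ 2 *: (star x * x) - a *: x]addrC.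
  rewrite [- (a *: x) + _ + _]addrACA subrr addr0 [RHS]addrACA [LHS]addrACA.
  by rewrite [- (a *: star x) + _]addrC.
by apply: S_add; [apply: S_sqr | apply: S_scale; rewrite ?sqr_ge0].
Qed.

Lemma exists_state : (forall x, exists c : R, real_part_in (c%:A - x)) ->
  exists phi : A -> R,
    [/\ forall x y, phi (x + y) = phi x + phi y,
        forall c x, phi (c *: x) = c * phi x, phi 1 = 1,
        forall x, phi (star x) = phi x & forall x, S x -> 0 <= phi x].
Proof.
move=> unitP.
have S0 : S 0 by rewrite -(scale0r (star 1 * 1)); apply: S_scale.
have P0 x : x + star x = 0 -> real_part_in x by rewrite /real_part_in => ->.
have [|||phi [phiD phiZ phi1 phiP]] := @positive_functional R A 1 real_part_in.
- split; first by apply: P0; rewrite star_algebra0 addr0.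
    exact: real_part_inD.
  by move=> c x c0 Px; rewrite /real_part_in starZ -scalerDr; apply: S_scale.
- split; last exact: unitP.
  rewrite /real_part_in star_algebra1; apply: S_add;
    by rewrite -[1]mulr1 -{1}star_algebra1; apply: S_sqr.
- rewrite /real_part_in star_algebraN star_algebra1 => H; apply: S_proper.
  have -> : -1 = 2^-1 *: (-1 - 1) :> A.
    by rewrite -mulr2n -scaler_nat scalerA mulVf ?scale1r // pnatr_eq0.
  by apply: S_scale; rewrite ?invr_ge0.
exists phi; split=> // x.
- have phiN y : phi (- y) = - phi y by rewrite -scaleN1r phiZ mulN1r.
  have E y : 0 <= phi (y - star y).
    apply: phiP; apply: P0; rewrite starD star_algebraN starK.
    by rewrite addrA subrK subrr.
  have := E x; have := E (star x); rewrite starK !phiD !phiN => H1 H2.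
  by apply: le_anti; apply/andP; split; lra.
by move=> Sx; apply: phiP; apply: S_add => //; apply: S_star.
Qed.

End States.

(** * The semi-inner product of a state, and compression to finite dimension *)

Section Compression.
Variable phi : A -> R.
Hypotheses (phiD : forall x y, phi (x + y) = phi x + phi y)
  (phiZ : forall (c : R) x, phi (c *: x) = c * phi x)
  (phi_star : forall x, phi (star x) = phi x)
  (phi_sqr : forall x, 0 <= phi (star x * x)).

Definition null x := phi (star x * x) = 0.

Lemma state0 : phi 0 = 0.
Proof. by rewrite -[0 in LHS](scale0r (0 : A)) phiZ mul0r. Qed.

Lemma stateB x y : phi (x - y) = phi x - phi y.
Proof. by rewrite phiD -scaleN1r phiZ mulN1r. Qed.

Lemma state_sum (T : Type) (s : seq T) (F : T -> A) :
  phi (\sum_(i <- s) F i) = \sum_(i <- s) phi (F i).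
Proof. exact: (big_morph phi phiD state0). Qed.

(** Degenerate Cauchy-Schwarz again; it makes the null elements a subspace orthogonal to
    everything. *)
Lemma state_null x z : null z -> phi (star x * z) = 0.
Proof.
move=> z0; suff : 2 * phi (star x * z) = 0 by lra.
apply: (@affine_ge0_eq0 _ (phi (star x * x))) => t.
have := phi_sqr (x + t *: z); rewrite starD starZ mulrDl !mulrDr.
rewrite -!scalerAl -!scalerAr !phiD !phiZ z0.
have -> : phi (star z * x) = phi (star x * z) by rewrite -phi_star starM starK.
by lra.
Qed.

Lemma nullD x y : null x -> null y -> null (x + y).
Proof.
move=> x0 y0; rewrite /null starD mulrDl !mulrDr !phiD.
by rewrite (state_null _ x0) (state_null _ y0) (state_null _ x0) (state_null _ y0) !addr0.
Qed.

Lemma nullZ (c : R) x : null x -> null (c *: x).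
Proof. by move=> x0; rewrite /null -scalerAr phiZ state_null // mulr0. Qed.

Definition projection (X : seq A) p := \sum_(x <- X) phi (star x * p) *: x.

(** For orthonormal [X], the class of [p] modulo null elements lies in the span of [X]. This
    expresses membership in a subspace of the Hilbert space without forming the quotient. *)
Definition captured X p := null (p - projection X p).

Lemma capturedD X p q : captured X p -> captured X q -> captured X (p + q).
Proof.
move=> Hp Hq; rewrite /captured (_ : projection X (p + q) = projection X p + projection X q).
  by rewrite opprD addrACA; apply: nullD.
by rewrite -big_split; apply: eq_bigr => x _ /=; rewrite mulrDr phiD scalerDl.
Qed.

Lemma capturedZ X (c : R) p : captured X p -> captured X (c *: p).
Proof.
move=> Hp; rewrite /captured (_ : projection X (c *: p) = c *: projection X p).
  by rewrite -scalerBr; apply: nullZ.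
by rewrite scaler_sumr; apply: eq_bigr => x _ /=; rewrite -scalerAr phiZ scalerA.
Qed.

Definition orthonormal (X : seq A) := forall i j, (i < size X)%N -> (j < size X)%N ->
  phi (star X`_i * X`_j) = (i == j)%:R.

Lemma state_projection X y p :
  phi (y * projection X p) = \sum_(x <- X) phi (star x * p) * phi (y * x).
Proof.
rewrite mulr_sumr state_sum; apply: eq_bigr => x _.
by rewrite -scalerAr phiZ.
Qed.

Lemma state_captured X y p : captured X p ->
  phi (y * p) = \sum_(x <- X) phi (star x * p) * phi (y * x).
Proof.
move=> Xp; rewrite -state_projection; apply/eqP; rewrite -subr_eq0 -stateB -mulrBr.
by rewrite -[y]starK state_null.
Qed.

Lemma projection_orthogonal X p i : orthonormal X -> (i < size X)%N ->
  phi (star X`_i * (p - projection X p)) = 0.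
Proof.
move=> orth iX; rewrite mulrBr stateB state_projection (big_nth 0) big_mkord.
rewrite (bigD1 (Ordinal iX)) //= orth // eqxx mulr1 big1 ?addr0 ?subrr // => j ji.
by rewrite orth // -[_ == _]/(Ordinal iX == j) eq_sym (negbTE ji) mulr0.
Qed.

(** Gram-Schmidt for a degenerate form: a vector whose residual [v] is null is already captured and
    contributes no basis element. *)
Lemma gram_schmidt (s : seq A) : exists X, orthonormal X /\ forall p, p \in s -> captured X p.
Proof.
elim: s => [|w s [X [orth Xs]]]; first by exists [::].
pose v := w - projection X w.
have [v0|vn0] := eqVneq (phi (star v * v)) 0.
  by exists X; split=> // p; rewrite inE => /predU1P[->|/Xs].
pose n : A := (Num.sqrt (phi (star v * v)))^-1 *: v.
have n1 : phi (star n * n) = 1.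
  rewrite /n starZ -scalerAl -scalerAr scalerA phiZ -invfM -expr2.
  by rewrite sqr_sqrtr ?mulVf.
have vX i : (i < size X)%N -> phi (star X`_i * v) = 0 by apply: projection_orthogonal.
have nX i : (i < size X)%N -> phi (star X`_i * n) = 0.
  by move=> iX; rewrite /n -scalerAr phiZ vX ?mulr0.
have Xn i : (i < size X)%N -> phi (star n * X`_i) = 0.
  by move=> iX; rewrite -phi_star starM starK nX.
exists (rcons X n); split.
  move=> i j; rewrite size_rcons !ltnS !nth_rcons.
  rewrite [(i <= _)%N]leq_eqVlt [(j <= _)%N]leq_eqVlt.
  move=> /predU1P[->|iX] /predU1P[->|jX]; rewrite ?ltnn ?eqxx.
  - exact: n1.
  - by rewrite jX Xn // gtn_eqF.
  - by rewrite iX nX // ltn_eqF.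
  by rewrite iX jX; apply: orth.
have old p : captured X p -> captured (rcons X n) p.
  move=> Xp; have np : phi (star n * p) = 0.
    rewrite (state_captured _ Xp) (big_nth 0) big_mkord big1 // => i _.
    by rewrite Xn ?mulr0.
  by rewrite /captured /projection big_rcons /= np scale0r addr0.
move=> p; rewrite inE => /predU1P[->|/Xs /old //].
rewrite /captured /projection big_rcons /= -/(projection X w).
have wE : phi (star n * w) *: n = v.
  have -> : w = v + projection X w by rewrite subrK.
  rewrite mulrDr phiD state_projection (big_nth 0) big_mkord big1; last first.
    by move=> i _; rewrite Xn ?mulr0.
  rewrite addr0 /n starZ -scalerAl phiZ scalerA mulrAC -invfM -expr2.
  by rewrite sqr_sqrtr ?mulVf ?scale1r.
rewrite wE (_ : w - _ = 0) /null ?mulr0 ?state0 //.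
by rewrite opprD addrA -/v subrr.
Qed.

Section Matrices.
Variables (X : seq A) (r : nat).
Hypothesis sizeX : size X = r.

Definition compression y : 'M[R]_r := \matrix_(i, j) phi (star X`_i * y * X`_j).
Definition coords p : 'cV[R]_r := \col_i phi (star X`_i * p).

(** Only [p] has to be captured: the coordinates of [y * p] are its inner products with [X], that
    is, those of its projection. *)
Lemma compression_coords y p :
  captured X p -> compression y *m coords p = coords (y * p).
Proof.
move=> Xp; apply/matrixP => i j; rewrite !mxE mulrA (state_captured _ Xp).
rewrite (big_nth 0) big_mkord sizeX; apply: eq_bigr => k _.
by rewrite !mxE mulrC.
Qed.

Lemma coordsD p q : coords (p + q) = coords p + coords q.
Proof. by apply/matrixP => i j; rewrite !mxE mulrDr phiD. Qed.

Lemma coordsZ (c : R) p : coords (c *: p) = c *: coords p.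
Proof. by apply/matrixP => i j; rewrite !mxE -scalerAr phiZ. Qed.

Lemma coords_sum (T : Type) (s : seq T) (F : T -> A) :
  coords (\sum_(i <- s) F i) = \sum_(i <- s) coords (F i).
Proof.
apply: (big_morph coords coordsD).
by apply/matrixP => i j; rewrite !mxE mulr0 state0.
Qed.

Lemma coords_neq0 p : captured X p -> phi (star p * p) != 0 -> coords p != 0.
Proof.
move=> Xp; apply: contraNneq => p0; rewrite (state_captured _ Xp).
rewrite (big_nth 0) big_mkord sizeX big1 // => i _.
by have /matrixP/(_ i 0) := p0; rewrite !mxE => ->; rewrite mul0r.
Qed.

Lemma compression_sum (T : Type) (s : seq T) (a : T -> R) (F : T -> A) :
  compression (\sum_(i <- s) a i *: F i) = \sum_(i <- s) a i *: compression (F i).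
Proof.
apply/matrixP => i j; rewrite summxE mxE mulr_sumr mulr_suml state_sum.
by apply: eq_bigr => k _; rewrite !mxE -scalerAr -scalerAl phiZ.
Qed.

Lemma compression_sym y : star y = y -> (compression y)^T = compression y.
Proof.
move=> yE; apply/matrixP => i j; rewrite !mxE -phi_star !starM starK yE.
by rewrite mulrA.
Qed.

Lemma compression_quadratic y (c : 'cV[R]_r) :
  (c^T *m compression y *m c) 0 0 =
  phi (star (\sum_(i < r) c i 0 *: X`_i) * y * (\sum_(i < r) c i 0 *: X`_i)).
Proof.
rewrite mulr_sumr state_sum mxE; apply: eq_bigr => j _.
rewrite star_algebra_sum !mulr_suml state_sum mxE mulr_suml; apply: eq_bigr => i _.
by rewrite !mxE starZ -!scalerAl -scalerAr !phiZ; ring.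
Qed.

End Matrices.

(* Only the powers below the degree of [f] have to be captured: the top power
   enters through [compression_coords] applied to the previous one. *)
Lemma horner_compression X r (sX : size X = r.+1) y (f : {poly R}) :
  (forall k, (k.+1 < size f)%N -> captured X (y ^+ k)) ->
  horner_mx (compression X r.+1 y) f *m coords X r.+1 1 = coords X r.+1 (horner_alg y f).
Proof.
move=> Hf.
have powE k : (k < size f)%N ->
    compression X r.+1 y ^+ k *m coords X r.+1 1 = coords X r.+1 (y ^+ k).
  elim: k => [|k IH] kf; first by rewrite !expr0 mul1mx.
  by rewrite !exprS -[_ * _]/(_ *m _) -mulmxA (IH (ltnW kf)) compression_coords //; exact: Hf.
have -> : horner_alg y f = \sum_(k < size f) f`_k *: y ^+ k.
  rewrite -{1}[f]coefK poly_def rmorph_sum /=; apply: eq_bigr => k _.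
  by rewrite -mul_polyC rmorphM /= horner_algC rmorphXn /= horner_algX mulr_algl.
rewrite coords_sum -{1}[f]coefK poly_def rmorph_sum mulmx_suml; apply: eq_bigr => k _.
rewrite coordsZ -powE //= -mul_polyC rmorphM /= horner_mx_C rmorphXn /= horner_mx_X.
by rewrite -[_ * _]/(_ *m _) -mulmxA mul_scalar_mx.
Qed.

End Compression.
End StarAlgebra.

(** * Sums of squares modulo an ideal *)

Lemma horner_algE (R : comNzRingType) (B : algType R) (y : B) (f : {poly R}) :
  horner_alg y f = \sum_(k <- iota 0 (size f)) f`_k *: y ^+ k.
Proof.
rewrite -[in RHS](subn0 (size f)) -/(index_iota 0 (size f)) big_mkord.
rewrite -{1}[f]coefK poly_def rmorph_sum /=; apply: eq_bigr => k _.
by rewrite -mul_polyC rmorphM /= horner_algC rmorphXn /= horner_algX mulr_algl.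
Qed.

Section SumsOfSquares.
Variables (R : realType) (A : algType R) (star : A -> A) (gen : A -> Prop).

Definition two_sided_ideal (p : A) := exists t : seq (A * A * A),
  (forall x, x \in t -> gen x.1.2) /\ p = \sum_(x <- t) x.1.1 * x.1.2 * x.2.

Definition sos_mod_ideal (p : A) := exists s : seq A,
  two_sided_ideal (p - \sum_(b <- s) star b * b).

Hypotheses (starD : forall x y, star (x + y) = star x + star y)
  (starZ : forall (c : R) x, star (c *: x) = c *: star x)
  (starM : forall x y, star (x * y) = star y * star x)
  (starK : forall x, star (star x) = x)
  (star_gen : forall g, gen g -> star g = g).
Implicit Types x y z q p g : A.

Lemma ideal0 : two_sided_ideal 0.
Proof. by exists [::]; rewrite big_nil. Qed.

Lemma idealD p q : two_sided_ideal p -> two_sided_ideal q -> two_sided_ideal (p + q).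
Proof.
move=> [s [sg ->]] [t [tg ->]]; exists (s ++ t); rewrite big_cat; split=> // x.
by rewrite mem_cat => /orP[/sg|/tg].
Qed.

Lemma ideal_mul x p y : two_sided_ideal p -> two_sided_ideal (x * p * y).
Proof.
move=> [t [tg ->]]; exists [seq (x * w.1.1, w.1.2, w.2 * y) | w <- t]; split.
  by move=> _ /mapP[w wt ->]; apply: (tg w).
rewrite mulr_sumr mulr_suml big_map; apply: eq_bigr => z _ /=.
by rewrite !mulrA.
Qed.

Lemma idealZ (c : R) p : two_sided_ideal p -> two_sided_ideal (c *: p).
Proof.
by move=> /(ideal_mul c%:A 1); rewrite mulr1 mulr_algl.
Qed.

Lemma ideal_star p : two_sided_ideal p -> two_sided_ideal (star p).
Proof.
move=> [t [tg ->]]; exists [seq (star w.2, w.1.2, star w.1.1) | w <- t]; split.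
  by move=> _ /mapP[w wt ->]; apply: (tg w).
rewrite (star_algebra_sum starD starZ) big_map big_seq [RHS]big_seq.
by apply: eq_bigr => z /tg zg /=; rewrite !starM (star_gen zg) mulrA.
Qed.

Lemma ideal_gen g : gen g -> two_sided_ideal g.
Proof.
move=> gg; exists [:: (1, g, 1)]; rewrite big_seq1 /= mul1r mulr1; split=> // x.
by rewrite inE => /eqP->.
Qed.

Lemma sos_ideal_ideal p : two_sided_ideal p -> sos_mod_ideal p.
Proof. by move=> Ip; exists [::]; rewrite big_nil subr0. Qed.

Lemma sos_ideal_add p q : sos_mod_ideal p -> sos_mod_ideal q -> sos_mod_ideal (p + q).
Proof.
move=> [s Is] [t It]; exists (s ++ t); rewrite big_cat /= opprD addrACA.
exact: idealD.
Qed.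

Lemma sos_ideal_sqr b : sos_mod_ideal (star b * b).
Proof. by exists [:: b]; rewrite big_seq1 subrr; apply: ideal0. Qed.

Lemma sos_ideal_conj q p : sos_mod_ideal p -> sos_mod_ideal (star q * p * q).
Proof.
move=> [s Is]; exists [seq b * q | b <- s].
rewrite big_map (_ : _ - _ = star q * (p - \sum_(b <- s) star b * b) * q).
  exact: ideal_mul.
rewrite mulrBr mulrBl mulr_sumr mulr_suml; congr (_ - _).
by apply: eq_bigr => b _; rewrite starM !mulrA.
Qed.

Lemma sos_ideal_scale (c : R) p : 0 <= c -> sos_mod_ideal p -> sos_mod_ideal (c *: p).
Proof.
move=> c0 /(sos_ideal_conj (Num.sqrt c)%:A).
rewrite starZ (star_algebra1 starM starK) mulr_algl mulr_algr scalerA.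
by rewrite -expr2 sqr_sqrtr.
Qed.

Lemma sos_ideal_star p : sos_mod_ideal p -> sos_mod_ideal (star p).
Proof.
move=> [s /ideal_star Is]; exists s; move: Is.
rewrite starD (star_algebraN starZ) (star_algebra_sum starD starZ).
by rewrite (eq_bigr (fun b => star b * b)) // => b _; rewrite starM starK.
Qed.

Lemma star_algebraX p k : star (p ^+ k) = star p ^+ k.
Proof.
elim: k => [|k IH]; first by rewrite !expr0 (star_algebra1 starM starK).
by rewrite exprS starM IH exprSr.
Qed.

Lemma star_algebra_horner (f : {poly R}) p :
  star p = p -> star (horner_alg p f) = horner_alg p f.
Proof.
move=> pE; rewrite horner_algE (star_algebra_sum starD starZ); apply: eq_bigr => k _.
by rewrite starZ star_algebraX pE.
Qed.

(** Substituting a selfadjoint [y] turns squares into hermitian squares and multiples of [f] into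
    elements of the ideal, so univariate certificates carry over. *)
Lemma sos_ideal_horner (f p : {poly R}) y : star y = y -> gen (horner_alg y f) ->
  sos_mod f p -> sos_mod_ideal (horner_alg y p).
Proof.
move=> yE yf [s [u ->]]; rewrite rmorphD rmorph_sum rmorphM /=; apply: sos_ideal_add.
  exists [seq horner_alg y k | k <- s]; rewrite big_map.
  rewrite (_ : _ - _ = 0); first exact: ideal0.
  apply/eqP; rewrite subr_eq0; apply/eqP; apply: eq_bigr => q _.
  by rewrite star_algebra_horner // rmorphXn expr2.
apply: sos_ideal_ideal; rewrite -[X in two_sided_ideal X]mulr1.
exact/ideal_mul/ideal_gen.
Qed.

Lemma bounded_real_rooted (f : {poly R}) y : star y = y -> gen (horner_alg y f) ->
  only_real_roots f -> bounded star sos_mod_ideal y.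
Proof.
move=> yE yf /real_rooted_bound[c c0 /(sos_ideal_horner yE yf)].
rewrite rmorphB rmorphXn /= horner_algC horner_algX expr2 => H.
by exists c; rewrite ?ltW // yE.
Qed.

(** Both [p] and its negative lie in the ideal, hence in the cone. *)
Lemma state_ideal (phi : A -> R) p :
  (forall x y, phi (x + y) = phi x + phi y) -> (forall c x, phi (c *: x) = c * phi x) ->
  (forall x, sos_mod_ideal x -> 0 <= phi x) -> two_sided_ideal p -> phi p = 0.
Proof.
move=> phiD phiZ phiS Ip; apply: le_anti; rewrite (phiS _ (sos_ideal_ideal Ip)) andbT.
have := phiS _ (sos_ideal_ideal (idealZ (-1) Ip)).
by rewrite phiZ mulN1r oppr_ge0.
Qed.

(** Restricting to polynomials in [y], sandwiched between [star q] and [q], gives a positive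
    functional on univariate polynomials that kills [f]; [functional_X_ge0] applies to it. *)
Lemma state_real_rooted_ge0 (phi : A -> R) (f : {poly R}) y q :
  (forall x y, phi (x + y) = phi x + phi y) -> (forall c x, phi (c *: x) = c * phi x) ->
  (forall x, sos_mod_ideal x -> 0 <= phi x) ->
  star y = y -> gen (horner_alg y f) -> only_nonneg_roots f ->
  0 <= phi (star q * y * q).
Proof.
move=> phiD phiZ phiS yE yf fr.
pose L (p : {poly R}) := phi (star q * horner_alg y p * q).
have LD (p1 p2 : {poly R}) : L (p1 + p2) = L p1 + L p2 by rewrite /L rmorphD mulrDr mulrDl phiD.
have LZ (c : R) (p : {poly R}) : L (c *: p) = c * L p.
  rewrite /L -mul_polyC rmorphM /= horner_algC mulr_algl.
  by rewrite -scalerAr -scalerAl phiZ.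
have Lsqr (p : {poly R}) : 0 <= L (p ^+ 2).
  apply: phiS; rewrite rmorphXn /= expr2 mulrA -mulrA.
  rewrite -{1}(star_algebra_horner p yE) -starM.
  exact: sos_ideal_sqr.
have Lf u : L (f * u) = 0.
  apply: state_ideal => //; rewrite rmorphM /= mulrA -mulrA.
  exact/ideal_mul/ideal_gen.
have := functional_X_ge0 LD LZ Lsqr 1 fr Lf.
by rewrite expr1n mulr1 /L horner_algX.
Qed.

End SumsOfSquares.

(** * The free algebra *)

Section FreeAlgebraType.
Import monalg.

HB.instance Definition _ (n : nat) := Choice.copy (word n) (seq 'I_n).

Lemma word_unit n (x y : word n) : x ++ y = [::] -> x = [::] /\ y = [::].
Proof. by case: x. Qed.

HB.instance Definition _ (n : nat) := Choice_isMonomialDef.Build (word n)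
  (@catA _) (@cat0s _) (@cats0 _) (@word_unit n).

(** Real coefficients are enough: the generators of the ideal are real, and a real certificate for
    -1 is also a complex one. *)
Definition falg (R : realType) (n : nat) := {malg R[word n]}.

End FreeAlgebraType.

Section FreeAlgebra.
Import monalg.
Variables (R : realType) (n : nat).

HB.instance Definition _ := GRing.Lalgebra.on (falg R n).

Local Notation A := (falg R n).
Local Notation C := (R[i]).
Local Notation "p @_ w" := (monalg.mcoeff w p) : ring_scope.
Implicit Types (p q : A) (w v : word n).

Definition mono (w : word n) : A := << w >>.

Lemma mcoeff_mono w v : (mono w)@_v = (w == v)%:R.
Proof. exact: mcoeffU1. Qed.

Lemma falgE p : p = \sum_(w <- finsupp (malg_val p)) p@_w *: mono w.
Proof.
rewrite {1}[p]monalgE; apply: eq_bigr => w _.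
by apply/malgP => v; rewrite mcoeffZ mcoeff_mono mcoeffU mulr_natr.
Qed.

Lemma falg_ind (P : A -> Prop) : P 0 -> (forall c w p, P p -> P (c *: mono w + p)) ->
  forall p, P p.
Proof.
by move=> P0 PD p; rewrite [p]falgE; elim/big_rec: _ => // w q _; apply: PD.
Qed.

Lemma monoM w v : mono w * mono v = mono (w ++ v).
Proof. by rewrite [LHS]malgM_def fgmulUU mulr1. Qed.

Lemma mono0 : mono [::] = 1.
Proof. by []. Qed.

Lemma scale_monoE (c : R) w : c *: mono w = << c *g w >> :> A.
Proof. by apply/malgP => v; rewrite mcoeffZ mcoeff_mono mcoeffU mulr_natr. Qed.

Lemma mono_scaleM (c d : R) w v : (c *: mono w) * (d *: mono v) = (c * d) *: mono (w ++ v).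
Proof. by rewrite !scale_monoE [LHS]malgM_def fgmulUU. Qed.

Lemma falg_scaleAr (c : R) p q : c *: (p * q) = p * (c *: q).
Proof.
elim/falg_ind: p => [|a w p IH]; first by rewrite !mul0r scaler0.
rewrite [_ * q]mulrDl [_ * (c *: q)]mulrDl scalerDr IH; congr (_ + _).
elim/falg_ind: q {IH} => [|b v q IHq]; first by rewrite scaler0 !mulr0 scaler0.
rewrite [_ * (_ + _)]mulrDr.
rewrite scalerDr IHq scalerDr mulrDr; congr (_ + _).
by rewrite scalerA !mono_scaleM scalerA [a * (c * b)]mulrCA.
Qed.

HB.instance Definition _ := GRing.Lalgebra_isAlgebra.Build R (falg R n) falg_scaleAr.

Definition star p : A := \sum_(w <- finsupp (malg_val p)) p@_w *: mono (rev w).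

Lemma mcoeff_star p v : (star p)@_v = p@_(rev v).
Proof.
rewrite /star raddf_sum /=.
under eq_bigr do rewrite mcoeffZ mcoeff_mono.
have [vp|vp] := boolP (rev v \in finsupp (malg_val p)).
  rewrite (bigD1_seq (rev v) vp (fset_uniq _)) /= revK eqxx mulr1 big1 ?addr0 // => w wv.
  by rewrite (can2_eq revK revK) (negbTE wv) mulr0.
rewrite big_seq big1 ?(mcoeff_outdom vp) // => w wp.
case: eqP => [vE|_]; last by rewrite mulr0.
by rewrite -vE revK wp in vp.
Qed.

Lemma star_is_linear : linear star.
Proof.
by move=> c p q; apply/malgP => v; rewrite mcoeffD mcoeffZ !mcoeff_star mcoeffD mcoeffZ.
Qed.
HB.instance Definition _ := GRing.isLinear.Build R A A *:%R star star_is_linear.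

Lemma star0 : star 0 = 0.
Proof. exact: linear0. Qed.

Lemma starD p q : star (p + q) = star p + star q.
Proof. exact: linearD. Qed.

Lemma starZ (c : R) p : star (c *: p) = c *: star p.
Proof. exact: linearZ. Qed.

Lemma star_mono w : star (mono w) = mono (rev w).
Proof.
by apply/malgP => v; rewrite mcoeff_star !mcoeff_mono (can2_eq revK revK).
Qed.

Lemma starK : involutive star.
Proof. by move=> p; apply/malgP => v; rewrite !mcoeff_star revK. Qed.

Lemma star1 : star 1 = 1.
Proof. by rewrite -mono0 star_mono. Qed.

Lemma starM p q : star (p * q) = star q * star p.
Proof.
elim/falg_ind: p => [|a w p IH]; first by rewrite mul0r !star0 mulr0.
have -> : (a *: mono w + p) * q = (a *: mono w) * q + p * q by exact: mulrDl.
rewrite [star (_ + p)]starD (mulrDr (star q)) starD IH.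
suff -> : star (a *: mono w * q) = star q * star (a *: mono w) by [].
elim/falg_ind: q {IH} => [|b v q IHq]; first by rewrite mulr0 !star0 mul0r.
have -> : (a *: mono w) * (b *: mono v + q) = (a *: mono w) * (b *: mono v) + (a *: mono w) * q.
  by exact: mulrDr.
rewrite [star (_ + q)]starD (mulrDl (star (b *: mono v))) starD IHq.
by rewrite mono_scaleM !starZ !star_mono mono_scaleM rev_cat [b * a]mulrC.
Qed.

Definition dot (a : 'I_n -> R) : A := \sum_i a i *: mono [:: i].

Lemma star_dot a : star (dot a) = dot a.
Proof. by rewrite /dot linear_sum; apply: eq_bigr => i _; rewrite /= starZ star_mono. Qed.

Variables (h : mpoly n R) (e : 'I_n -> R).

Definition falg_gen (g : A) :=
  (exists a, g = horner_alg (dot a) (hae h a e)) \/ g = 1 - dot e.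

Lemma star_falg_gen g : falg_gen g -> star g = g.
Proof.
case=> [[a ->]|->]; first exact: (star_algebra_horner starD starZ starM starK _ (star_dot a)).
by rewrite starD -scaleN1r starZ star_dot star1.
Qed.

(** * Comparison with the encoding by lists of complex terms *)

Section Represents.

Definition represents (q : ncpoly R n) (p : A) := forall w, nccoef q w = (p@_w)%:C%C.

Lemma nccoef_cat (q r : ncpoly R n) w : nccoef (q ++ r) w = nccoef q w + nccoef r w.
Proof. by rewrite /nccoef big_cat. Qed.

Lemma nccoef_scale c (q : ncpoly R n) w : nccoef (ncscale c q) w = c * nccoef q w.
Proof.
rewrite /nccoef big_map mulr_sumr; apply: eq_bigr => x _ /=.
by case: eqP; rewrite ?mulr0.
Qed.

Lemma represents_add (q r : ncpoly R n) p p' :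
  represents q p -> represents r p' -> represents (ncadd q r) (p + p').
Proof. by move=> E E' w; rewrite nccoef_cat E E' mcoeffD rmorphD. Qed.

Lemma represents_scale (c : R) (q : ncpoly R n) p :
  represents q p -> represents (ncscale c%:C%C q) (c *: p).
Proof. by move=> E w; rewrite nccoef_scale E mcoeffZ rmorphM. Qed.

Lemma represents_opp (q : ncpoly R n) p : represents q p -> represents (ncopp q) (- p).
Proof. by move=> E w; rewrite nccoef_scale E mcoeffN rmorphN mulN1r. Qed.

Lemma represents_mono (c : R) w : represents [:: (c%:C%C, w)] (c *: mono w).
Proof.
move=> v; rewrite /nccoef big_seq1 /= mcoeffZ mcoeff_mono.
by case: eqP; rewrite ?mulr1 ?mulr0.
Qed.

Lemma represents_one : represents (ncone R n) 1.
Proof. by have := represents_mono 1 [::]; rewrite scale1r. Qed.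

(** A list may repeat words or carry words that cancel, so both sums are regrouped over the common
    index set [d]. Products are then handled by evaluating one factor at a time. *)
Lemma represents_evaluation (q : ncpoly R n) p (f : word n -> C) : represents q p ->
  \sum_(x <- q) x.1 * f x.2 = \sum_(w <- finsupp (malg_val p)) (p@_w)%:C%C * f w.
Proof.
move=> E; pose d := undup (map snd q ++ finsupp (malg_val p)).
have sub (T : seq (word n)) (F : word n -> C) : uniq T -> {subset T <= d} ->
    (forall w, w \notin T -> F w = 0) -> \sum_(w <- T) F w = \sum_(w <- d) F w.
  move=> uT Td F0; rewrite [RHS](bigID (mem T)) /= [X in _ + X]big1 ?addr0; last by move=> w; apply: F0.
  rewrite -[RHS]big_filter; apply: perm_big; apply: uniq_perm => //; first exact/filter_uniq/undup_uniq.
  by move=> w; rewrite mem_filter; case: (boolP (w \in T)) => // /Td.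
rewrite (sub _ (fun w => (p@_w)%:C%C * f w)) ?fset_uniq //; first last.
- by move=> w /mcoeff_outdom ->; rewrite mul0r.
- by move=> w wp; rewrite mem_undup mem_cat wp orbT.
transitivity (\sum_(w <- d) nccoef q w * f w); last by apply: eq_bigr => w _; rewrite E.
under [RHS]eq_bigr do rewrite /nccoef mulr_suml.
rewrite exchange_big /= big_seq [RHS]big_seq; apply: eq_bigr => x xq.
rewrite (bigD1_seq x.2) ?undup_uniq //= ?eqxx; last first.
  by rewrite mem_undup mem_cat map_f.
by rewrite big1 ?addr0 // => w; rewrite eq_sym => /negbTE ->; rewrite mul0r.
Qed.

Lemma represents_mul (q r : ncpoly R n) p p' :
  represents q p -> represents r p' -> represents (ncmul q r) (p * p').
Proof.
move=> E E' w; rewrite /nccoef big_allpairs_dep /=.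
transitivity (\sum_(x <- q) x.1 * (\sum_(y <- r) y.1 * (x.2 ++ y.2 == w)%:R)).
  apply: eq_bigr => x _; rewrite mulr_sumr; apply: eq_bigr => y _.
  by case: eqP; rewrite ?mulr1 ?mulr0.
rewrite (represents_evaluation (fun u => \sum_(y <- r) y.1 * (u ++ y.2 == w)%:R) E).
rewrite [p in RHS]falgE [p' in RHS]falgE mulr_suml raddf_sum rmorph_sum /=.
apply: eq_bigr => u _; rewrite (represents_evaluation (fun v => (u ++ v == w)%:R) E').
rewrite mulr_sumr mulr_sumr raddf_sum rmorph_sum; apply: eq_bigr => v _ /=.
rewrite -scalerAl -scalerAr monoM !mcoeffZ mcoeff_mono !rmorphM /= mulrA.
by rewrite -mulrA rmorph_nat.
Qed.

Lemma represents_star (q : ncpoly R n) p : represents q p -> represents (ncstar q) (star p).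
Proof.
move=> E w; rewrite mcoeff_star.
have -> : (p@_(rev w))%:C%C = ((nccoef q (rev w))^*)%C.
  by rewrite E; apply/eqP; rewrite eq_complex /= oppr0 !eqxx.
rewrite /nccoef big_map rmorph_sum; apply: eq_bigr => x _ /=.
rewrite (can2_eq revK revK); case: eqP => // _.
by rewrite rmorph0.
Qed.

Lemma represents_pow (q : ncpoly R n) p k : represents q p -> represents (ncpow q k) (p ^+ k).
Proof.
move=> E; elim: k => [|k IH]; first exact: represents_one.
by rewrite exprS; apply: represents_mul.
Qed.

Lemma represents_sum_map (T : eqType) (s : seq T) (F : T -> ncpoly R n) (G : T -> A) :
  (forall x, x \in s -> represents (F x) (G x)) ->
  represents (ncsum [seq F x | x <- s]) (\sum_(x <- s) G x).
Proof.
elim: s => [_ w|x s IH H]; first by rewrite big_nil mcoeff0 /nccoef big_nil.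
rewrite big_cons; apply: represents_add; first by apply: H; rewrite mem_head.
by apply: IH => y ys; apply: H; rewrite inE ys orbT.
Qed.

Lemma represents_dot a : represents (ncdot a) (dot a).
Proof.
have -> : ncdot a = ncsum [seq [:: ((a i)%:C%C, [:: i])] | i <- enum 'I_n].
  by rewrite /ncdot /ncsum; elim: (enum _) => //= i s ->.
rewrite /dot -[X in \sum_(i <- X) _]enumT.
by apply: represents_sum_map => i _; apply: represents_mono.
Qed.

Lemma represents_poly (f : {poly R}) (q : ncpoly R n) p :
  represents q p -> represents (nc_of_poly f q) (horner_alg p f).
Proof.
move=> E; rewrite /nc_of_poly.
by rewrite horner_algE; apply: represents_sum_map => k _; apply/represents_scale/represents_pow.
Qed.

Definition nc_of_falg p : ncpoly R n :=
  ncsum [seq [:: ((p@_w)%:C%C, w)] | w <- finsupp (malg_val p)].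

Lemma represents_nc_of_falg p : represents (nc_of_falg p) p.
Proof. by rewrite {2}[p]falgE; apply: represents_sum_map => w _; apply: represents_mono. Qed.

Lemma represents_gen (g : A) : falg_gen g -> exists2 q, Jgen h e q & represents q g.
Proof.
move=> [[a ->]|->].
  exists (nc_of_poly (hae h a e) (ncdot a)); first by left; exists a.
  exact/represents_poly/represents_dot.
exists (ncadd (ncone R n) (ncopp (ncdot e))); first by right.
exact/(represents_add represents_one)/represents_opp/represents_dot.
Qed.

Lemma sos_falg_neg1 : sos_mod_ideal star falg_gen (-1) -> neg1_in_SOS h e.
Proof.
move=> [s [t [tJ E]]]; exists (map nc_of_falg s).
have [t' t'J Et'] : exists2 t' : seq (ncpoly R n * ncpoly R n * ncpoly R n),
    (forall x, x \in t' -> Jgen h e x.1.2) &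
    represents (ncsum [seq ncmul (ncmul x.1.1 x.1.2) x.2 | x <- t'])
      (\sum_(x <- t) x.1.1 * x.1.2 * x.2).
  elim: t tJ {E} => [|x t IH] tJ; first by exists [::] => // w; rewrite big_nil mcoeff0 /nccoef big_nil.
  have [|t' t'J Et'] := IH; first by move=> y yt; apply: tJ; rewrite inE yt orbT.
  have [|q qJ qE] := represents_gen (g := x.1.2); first by apply: tJ; rewrite mem_head.
  exists ((nc_of_falg x.1.1, q, nc_of_falg x.2) :: t').
    by move=> y; rewrite inE => /predU1P[->//|/t'J].
  rewrite big_cons; apply: represents_add => //=.
  by do 2?[apply: represents_mul => //]; apply: represents_nc_of_falg.
exists t'; split=> // w; rewrite Et' -E.
apply: represents_add; first exact/represents_opp/represents_one.
apply: represents_opp; rewrite -map_comp; apply: represents_sum_map => b _ /=.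
apply: represents_mul; first apply: represents_star; exact: represents_nc_of_falg.
Qed.

End Represents.
End FreeAlgebra.

(** * Divisibility of the characteristic polynomial *)

Section GenericLine.
Variables (F : fieldType) (n : nat).
Implicit Types (e : 'I_n -> F) (h : {mpoly F[n]}).

(* The polynomial [h(x - t e)] in [t], with indeterminate [x]. *)
Definition generic_line e : {mpoly F[n]} -> {poly {mpoly F[n]}} :=
  mmap (polyC \o @mpolyC n F) (fun i => ('X_i)%:P - (e i)%:MP%:P * 'X).
HB.instance Definition _ e := GRing.RMorphism.on (generic_line e).

(** Extends [generic_line e] by fixing the variable [t]. The substitution of [x - t e] for [x] thus
    becomes an automorphism, inverted by the opposite direction, and it carries the prime constant
    [h] to [h(x - t e)]. *)
Definition shear e (p : {poly {mpoly F[n]}}) : {poly {mpoly F[n]}} :=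
  (map_poly (generic_line e) p).['X].

Lemma shear_is_zmod_morphism e : zmod_morphism (shear e).
Proof. by move=> p q; rewrite /shear rmorphB hornerD hornerN. Qed.

Lemma shear_is_monoid_morphism e : monoid_morphism (shear e).
Proof.
by split=> [|p q]; rewrite /shear ?rmorph1 ?hornerC // rmorphM hornerM.
Qed.

HB.instance Definition _ e := GRing.isZmodMorphism.Build _ _ (shear e) (shear_is_zmod_morphism e).
HB.instance Definition _ e := GRing.isMonoidMorphism.Build _ _ (shear e) (shear_is_monoid_morphism e).

Lemma generic_lineC e c : generic_line e c%:MP = c%:MP%:P.
Proof. by rewrite /generic_line mmapC. Qed.

Lemma generic_lineX e i : generic_line e 'X_i = ('X_i)%:P - (e i)%:MP%:P * 'X.
Proof. by rewrite /generic_line mmapX mmap1U. Qed.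

Lemma shearC e c : shear e c%:P = generic_line e c.
Proof. by rewrite /shear map_polyC /= hornerC. Qed.

Lemma shearX e : shear e 'X = 'X.
Proof. by rewrite /shear map_polyX hornerX. Qed.

Lemma shear_opp e e' : (forall i, e' i = - e i) -> cancel (shear e) (shear e').
Proof.
move=> ee'; have lineK c : shear e' (generic_line e c) = c%:P.
  apply: (@mpoly_rmorph_eq n F _ (shear e' \o generic_line e) polyC) => [a|i] /=.
    by rewrite generic_lineC shearC generic_lineC.
  rewrite generic_lineX rmorphB rmorphM /= shearX !shearC generic_lineX generic_lineC ee'.
  by rewrite !rmorphN /= mulNr opprK addrK.
elim/poly_ind=> [|p c IH]; first by rewrite !rmorph0.
have E : shear e (p * 'X + c%:P) = shear e p * 'X + generic_line e c.
  by rewrite rmorphD rmorphM /= shearX shearC.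
apply: etrans (congr1 (shear e') E) _; move: IH; set q := shear e p => IH.
have -> : shear e' (q * 'X + generic_line e c) = shear e' q * 'X + shear e' (generic_line e c).
  by rewrite rmorphD rmorphM /= shearX.
by rewrite IH lineK.
Qed.

Lemma prime_generic_line e h : prime_elt h -> prime_elt (generic_line e h).
Proof.
move=> ph; rewrite -shearC; pose e' i := - e i.
have [fK gK] : cancel (shear e) (shear e') /\ cancel (shear e') (shear e).
  by split; apply: shear_opp => i; rewrite /e' ?opprK.
exact: prime_iso fK gK (prime_polyC ph).
Qed.

(** Were the two polynomials coprime over the fraction field, a Bezout relation and Cayley-Hamilton
    would give [c *: v = 0] with [c] nonzero. So [u * H = w * chi] with [w] nonzero of degree below
    that of [H]; the prime [H] cannot divide [w] and divides [chi]. *)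
Lemma generic_line_divides_annihilated r e h (A : 'M[{mpoly F[n]}]_r.+1)
    (v : 'cV[{mpoly F[n]}]_r.+1) :
  prime_elt h -> v != 0 -> horner_mx A (generic_line e h) *m v = 0 ->
  divides (generic_line e h) (char_poly A).
Proof.
move=> hp v0 Hv; have Hp := prime_generic_line e hp.
set H := generic_line e h in Hv Hp *; set chi := char_poly A.
have H0 : H != 0 by case: Hp.
have chi0 : chi != 0 by rewrite monic_neq0 // char_poly_monic.
have : ~~ coprimep H chi.
  apply/negP => /Pdiv.Idomain.Bezout_coprimepP[[u w]] /=.
  rewrite -size_poly_eq1 => /size_poly1P[c c0 E].
  have : horner_mx A (u * H + w * chi) *m v = c *: v.
    by rewrite E horner_mx_C mul_scalar_mx.
  rewrite rmorphD !rmorphM /= Cayley_Hamilton mulr0 addr0.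
  rewrite -[_ * _]/(_ *m _) -mulmxA Hv mulmx0 => /esym cv0.
  case/negP: v0; apply/eqP/matrixP => i j; rewrite mxE; apply/eqP.
  have /matrixP/(_ i j)/eqP := cv0; rewrite !mxE mulf_eq0 (negbTE c0) //.
case/(Pdiv.Idomain.Bezout_coprimepPn H0 chi0) => -[u w] /= /andP[_ /andP[w0 wH]] E.
have : divides H (w * chi) by exists u; rewrite E.
case/(prime_dividesM Hp) => // -[q wE].
have q0 : q != 0 by apply: contraTneq w0 => q0; rewrite wE q0 mul0r size_poly0.
by move: wH; rewrite wE size_mul // (polySpred q0) addSn /= ltnNge leq_addl.
Qed.

End GenericLine.

(** * Specialization at real points *)

Section Specialization.
Variables (R : realType) (n : nat).
Implicit Types (h : {mpoly R[n]}) (a e : 'I_n -> R).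

Lemma generic_line_eval h a e : map_poly (meval a) (generic_line e h) = hae h a e.
Proof.
apply: (@mpoly_rmorph_eq n R _ (map_poly (meval a) \o generic_line e)
  (mmap (@polyC R) (fun i => (a i)%:P - (e i)%:P * 'X))) => [c|i] /=.
  by rewrite generic_lineC map_polyC /= mevalC mmapC.
rewrite generic_lineX mmapX mmap1U rmorphB rmorphM /= !map_polyC map_polyX /=.
by rewrite mevalXU mevalC.
Qed.

(** At one point [a] the hypothesis yields just a common factor. Primality acts on the generic
    pencil [A], where the full divisibility holds, and evaluation at [a] preserves it. *)
Lemma hae_divides_char_poly r h e (M : 'I_n -> 'M[R]_r.+1) (xi : 'cV[R]_r.+1) :
  prime_elt h -> xi != 0 ->
  (forall a, horner_mx (\sum_j a j *: M j) (hae h a e) *m xi = 0) ->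
  forall a, exists q, char_poly (\sum_j a j *: M j) = q * hae h a e.
Proof.
move=> hp xi0 Hxi a.
pose A : 'M[{mpoly R[n]}]_r.+1 := \sum_j 'X_j *: map_mx (@mpolyC n R) (M j).
have Aev b : map_mx (meval b) A = \sum_j b j *: M j.
  rewrite map_mx_sum; apply: eq_bigr => j _; rewrite map_mxZ /= mevalXU.
  by congr (_ *: _); apply/matrixP => i k; rewrite !mxE mevalC.
have mpev b : map_mx (meval b) (map_mx (@mpolyC n R) xi) = xi.
  by apply/matrixP => i k; rewrite !mxE mevalC.
have [||q E] := @generic_line_divides_annihilated _ _ r e h A (map_mx (@mpolyC n R) xi) hp.
- by apply: contra_neq xi0 => E; rewrite -(mpev (fun=> 0)) E map_mx0.
- apply/matrixP => i j; rewrite [RHS]mxE; apply: mpoly_meval_eq0 => b.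
  have := Hxi b; rewrite -Aev -generic_line_eval -map_horner_mx -{1}(mpev b) -map_mxM.
  by move/matrixP/(_ i j); rewrite !mxE.
exists (map_poly (meval a) q); rewrite -Aev -generic_line_eval -rmorphM /= -E.
by rewrite map_char_poly.
Qed.

End Specialization.

(** * Real symmetric matrices and the spectrahedral description *)

Section RealSymmetric.
Variable R : realType.
Local Notation C := (R[i]).
Local Notation rc := (real_complex R).

Definition real_psd r (K : 'M[R]_r) := forall c : 'cV[R]_r, 0 <= (c^T *m K *m c) 0 0.

(** For [v = x + i y] the mixed terms cancel by symmetry of [K], leaving the sum of the real forms
    at [x] and at [y]. *)
Lemma psd_real_sym r (K : 'M[R]_r) : K^T = K -> psd (map_mx rc K) <-> real_psd K.
Proof.
move=> Ksym; split=> [H c|H v].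
  have := H (map_mx rc c).
  rewrite (_ : ctrmx _ = map_mx rc c^T).
    by rewrite -!map_mxM mxE /= -[0 : C]/(rc 0) lecR.
  by apply/matrixP => i j; rewrite !mxE /= oppr0.
pose x := map_mx (@complex.Re R) v; pose y := map_mx (@complex.Im R) v.
have -> : (ctrmx v *m map_mx rc K *m v) 0 0 =
    rc ((x^T *m K *m x) 0 0 + (y^T *m K *m y) 0 0).
  have vE : v = map_mx rc x + 'i%C *: map_mx rc y.
    by apply/matrixP => i j; rewrite !mxE /=; case: (v i j) => p q; simpc.
  have vcE : ctrmx v = map_mx rc x^T - 'i%C *: map_mx rc y^T.
    by apply/matrixP => i j; rewrite !mxE /=; case: (v _ _) => p q; simpc.
  have cross : x^T *m K *m y = y^T *m K *m x.
    rewrite -[LHS]trmxK [X in X^T = _](_ : _ = y^T *m K *m x); last first.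
      by rewrite !trmx_mul trmxK Ksym mulmxA.
    by apply/matrixP => i j; rewrite mxE !ord1.
  rewrite {2}vE vcE mulmxDl mulNmx mulmxDl mulmxDr mulNmx mulmxDr.
  rewrite -!scalemxAl -!scalemxAr -!map_mxM cross scalerA -expr2 sqr_i scaleN1r.
  rewrite opprB addrACA subrr addr0 mxE [X in X + _ = _]mxE [X in _ + X = _]mxE.
  by rewrite rmorphD.
by rewrite -[0 : C]/(rc 0) lecR addr_ge0.
Qed.

Lemma eigenvalue_psd_ge0 r (K : 'M[R]_r) (l : R) :
  real_psd K -> root (char_poly K) l -> 0 <= l.
Proof.
move=> Kpsd; rewrite -eigenvalue_root_char => /eigenvalueP[v vK v0].
have := Kpsd v^T; rewrite trmxK vK -scalemxAl mxE.
have vv : 0 < (v *m v^T) 0 0.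
  have [i vi] : exists i, v 0 i != 0.
    apply/existsP; apply: contraNT v0; rewrite negb_exists => /forallP H.
    by apply/eqP/rowP => i; rewrite mxE; have := H i; rewrite negbK => /eqP.
  rewrite mxE (bigD1 i) //= mxE -expr2; apply: ltr_wpDr; last by rewrite exprn_even_gt0.
  by apply: sumr_ge0 => j _; rewrite mxE -expr2 sqr_ge0.
by rewrite pmulr_lge0.
Qed.

Lemma spectrahedral_of_compression r n (h : {mpoly R[n]}) (e : 'I_n -> R)
    (M : 'I_n -> 'M[R]_r.+1) (xi : 'cV[R]_r.+1) :
  prime_elt h -> hyperbolic h e -> xi != 0 -> (forall j, (M j)^T = M j) ->
  (forall a, horner_mx (\sum_j a j *: M j) (hae h a e) *m xi = 0) ->
  (forall a, hcone h e a -> real_psd (\sum_j a j *: M j)) ->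
  exists (m : nat) (M : 'I_n -> 'M[R[i]]_m),
    (forall j, hermitian_mx (M j)) /\
    (forall a : 'I_n -> R, hcone h e a <-> psd (\sum_(j < n) ((a j)%:C)%C *: M j)).
Proof.
move=> hp [_ hyp] xi0 Msym Mxi Mpsd.
exists r.+1, (fun j => map_mx rc (M j)); split=> [j|a].
  by apply/matrixP => i k; rewrite !mxE /= oppr0 -{1}(Msym j) mxE.
have -> : \sum_(j < n) ((a j)%:C)%C *: map_mx rc (M j) = map_mx rc (\sum_j a j *: M j).
  by rewrite map_mx_sum; apply: eq_bigr => j _; rewrite map_mxZ.
rewrite psd_real_sym; last first.
  by rewrite linear_sum; apply: eq_bigr => j _; rewrite linearZ /= Msym.
split=> [/Mpsd //|Ka z rz]; have z0 := hyp a z rz; split=> //.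
have [q E] := hae_divides_char_poly hp xi0 Mxi a.
apply: (eigenvalue_psd_ge0 Ka); rewrite E rootM; apply/orP; right.
have zE : (complex.Re z)%:C%C = z by case: (z) z0 => p q' /= ->.
by rewrite -(fmorph_root rc) /= zE.
Qed.

End RealSymmetric.

(** * The compression attached to a hyperbolic polynomial *)

Section HyperbolicCompression.
Variables (R : realType) (n : nat) (h : {mpoly R[n]}) (e : 'I_n -> R).

(** The bound is uniform in [a], so a single finite set of words serves all directions at once. *)
Lemma size_hae a : (size (hae h a e) <= msize h)%N.
Proof.
rewrite /hae /mmap; apply: (leq_trans (size_sum _ _ _)).
apply/bigmax_leqP_seq => m mh _; rewrite mul_polyC.
apply: (leq_trans (size_scale_leq _ _)); apply: leq_trans (msize_mdeg_lt mh).
rewrite /mmap1 mdegE.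
elim/big_rec2: _ => [|i d q _ IH]; first by rewrite size_poly1.
apply: (leq_trans (size_polyMleq _ _)).
have sl : (size ((a i)%:P - (e i)%:P * 'X)%R <= 2)%N.
  rewrite (leq_trans (size_polyD _ _)) // geq_max size_polyN mul_polyC.
  by rewrite (leq_trans (size_polyC_leq1 _)) // (leq_trans (size_scale_leq _ _)) ?size_polyX.
have sX : (size (((a i)%:P - (e i)%:P * 'X) ^+ m i)%R <= (m i).+1)%N.
  apply: (leq_trans (size_poly_exp_leq _ _)); rewrite ltnS -[leqRHS]mul1n leq_mul2r.
  by rewrite -subn1 leq_subLR sl orbT.
move: sX IH; set x := size _; set y := size _; lia.
Qed.

Hypotheses (hyp : hyperbolic h e) (proper : ~ neg1_in_SOS h e).

Local Notation A := (falg R n).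
Local Notation star := (@star R n).
Local Notation gen := (@falg_gen R n h e).
Local Notation sos := (sos_mod_ideal star gen).
Local Notation dot := (@dot R n).
Local Notation mono := (@mono R n).

Let star_gen := @star_falg_gen R n h e.
Let sos_add := @sos_ideal_add R A star gen.
Let sos_scale := sos_ideal_scale (gen := gen) (@starZ R n) (@starM R n) (@starK R n).
Let sos_sqr := @sos_ideal_sqr R A star gen.
Let sos_conj := sos_ideal_conj (gen := gen) (@starM R n).

Lemma gen_dot a : gen (horner_alg (dot a) (hae h a e)).
Proof. by left; exists a. Qed.

Lemma mono_letter i : mono [:: i] = dot (fun j => (j == i)%:R).
Proof.
rewrite /dot (bigD1 i) //= eqxx scale1r big1 ?addr0 // => j /negbTE ->.
by rewrite scale0r.
Qed.

(** A letter is [dot a] for a unit vector [a], hence bounded through its own real-rooted generator;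
    boundedness is multiplicative. *)
Lemma bounded_mono w : bounded star sos (mono w).
Proof.
elim: w => [|i w IH].
  exact: (bounded1 (@starM R n) (@starK R n) sos_scale).
rewrite -[i :: w]/([:: i] ++ w) -monoM.
apply: (bounded_mul (@starM R n) sos_add sos_scale sos_conj _ IH).
rewrite mono_letter; apply: bounded_real_rooted (gen_dot _) _ => //.
- exact: starD.
- exact: starZ.
- exact: starM.
- exact: starK.
- exact: star_dot.
by case: hyp => _; apply.
Qed.

Lemma falg_order_unit (x : A) : exists c : R, real_part_in star sos (c%:A - x).
Proof.
elim/falg_ind: x => [|a w x [c Hc]].
  exists 0; rewrite /real_part_in scale0r subr0 star0 addr0.
  exact/sos_ideal_ideal/ideal0.
have [d Hd] := bounded_scale_unit (@starD R n) (@starZ R n) (@starM R n) (@starK R n)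
  sos_add sos_scale sos_sqr a (bounded_mono w).
exists (d + c).
have -> : (d + c)%:A - (a *: mono w + x) = (d%:A - a *: mono w) + (c%:A - x).
  by rewrite scalerDl opprD addrACA.
exact: (real_part_inD (@starD R n) sos_add Hd Hc).
Qed.

Lemma exists_falg_state : exists phi : A -> R,
  [/\ forall x y, phi (x + y) = phi x + phi y,
      forall c x, phi (c *: x) = c * phi x, phi 1 = 1,
      forall x, phi (star x) = phi x & forall x, sos x -> 0 <= phi x].
Proof.
apply: (exists_state (@starD R n) (@starZ R n) (@starM R n) (@starK R n)
  sos_add sos_scale sos_sqr _ _ falg_order_unit).
  exact: (sos_ideal_star (@starD R n) (@starZ R n) (@starM R n) (@starK R n) star_gen).
by move=> H; apply: proper; apply: sos_falg_neg1 H.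
Qed.

Lemma captured_dot_pow (phi : A -> R) X N :
  (forall x y, phi (x + y) = phi x + phi y) -> (forall c x, phi (c *: x) = c * phi x) ->
  (forall x, phi (star x) = phi x) -> (forall x, 0 <= phi (star x * x)) ->
  (forall w, (size w <= N)%N -> captured star phi X (mono w)) ->
  forall a k, (k <= N)%N -> captured star phi X (dot a ^+ k).
Proof.
move=> phiD phiZ phistar phisq HX a k kN.
have cD := capturedD (@starD R n) (@starZ R n) (@starM R n) (@starK R n) phiD phiZ phistar phisq.
have cZ := capturedZ (@starD R n) (@starZ R n) (@starM R n) (@starK R n) phiD phiZ phistar phisq.
(* Generalized so that the letters peeled off the power accumulate in the suffix [w]. *)
suff H w : (k + size w <= N)%N -> captured star phi X (dot a ^+ k * mono w).
  by have := H [::]; rewrite addn0 mono0 mulr1; apply.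
elim: k w {kN} => [|k IH] w; first by rewrite expr0 mul1r; apply: HX.
move=> kw; have -> : dot a ^+ k.+1 * mono w = \sum_i a i *: (dot a ^+ k * mono (i :: w)).
  rewrite exprSr -mulrA /dot mulr_suml mulr_sumr; apply: eq_bigr => i _.
  by rewrite -scalerAl monoM scalerAr.
apply: (big_ind (captured star phi X)) => [||i _].
- by have := cZ X 0 _ (HX [::] isT); rewrite scale0r.
- exact: cD.
by apply: cZ; apply: IH; rewrite /= addnS.
Qed.

Lemma exists_compression : exists r (M : 'I_n -> 'M[R]_r.+1) (xi : 'cV[R]_r.+1),
  [/\ xi != 0, forall j, (M j)^T = M j,
      forall a, horner_mx (\sum_j a j *: M j) (hae h a e) *m xi = 0 &
      forall a, hcone h e a -> real_psd (\sum_j a j *: M j)].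
Proof.
have [phi [phiD phiZ phi1 phistar phiS]] := exists_falg_state.
have phisq x : 0 <= phi (star x * x) by apply/phiS/sos_sqr.
(* The bounded sequences enumerate all words of length at most [msize h], which is the degree of [h]
   plus one. *)
have [X [_ HX]] := gram_schmidt (@starD R n) (@starZ R n) (@starM R n) (@starK R n)
  phiD phiZ phistar phisq [seq mono (val w) | w <- enum {: (msize h).-bseq 'I_n}].
have {}HX w : (size w <= msize h)%N -> captured star phi X (mono w).
  move=> wh; apply: HX; apply/mapP; exists (Bseq wh) => //.
  by rewrite mem_enum.
have X1 : captured star phi X 1 by rewrite -mono0; apply: HX.
have coords0 r : size X = r -> coords star phi X r 1 != 0.
  move=> sX; apply: (coords_neq0 (@starD R n) (@starZ R n) (@starM R n) (@starK R n)
    phiD phiZ phistar phisq sX X1).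
  by rewrite star1 mulr1 phi1 oner_neq0.
(* The space is nonzero because the class of 1 is; [horner_mx] asks for a matrix of successor
   size. *)
have [r sX] : exists r, size X = r.+1.
  case: (size X) (coords0 _ erefl) => [|r _]; last by exists r.
  by rewrite flatmx0 eqxx.
have dotE a : \sum_j a j *: compression star phi X r.+1 (mono [:: j]) =
    compression star phi X r.+1 (dot a) by rewrite (compression_sum _ phiD phiZ).
exists r, (fun j => compression star phi X r.+1 (mono [:: j])), (coords star phi X r.+1 1).
split; first exact: coords0.
- move=> j /=; apply: (compression_sym (@starM R n) (@starK R n) phistar).
  exact: star_mono.
- move=> a; rewrite dotE.
  rewrite (horner_compression (@starD R n) (@starZ R n) (@starM R n) (@starK R n)
    phiD phiZ phistar phisq sX).
    (* Each coordinate is the value of [phi] on a left multiple of a generator, an element of the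
       ideal. *)
    apply/matrixP => i j; rewrite !mxE.
    apply: (state_ideal (star := star) (gen := gen) phiD phiZ phiS).
    rewrite -[X in two_sided_ideal gen X]mulr1.
    exact/ideal_mul/ideal_gen/gen_dot.
  move=> k kh; apply: (captured_dot_pow phiD phiZ phistar phisq HX).
  by apply: ltnW; apply: ltnW; apply: leq_trans kh (size_hae a).
move=> a ha c; rewrite dotE (compression_quadratic (@starD R n) (@starZ R n) phiD phiZ).
apply: (state_real_rooted_ge0 (gen := gen) (@starD R n) (@starZ R n) (@starM R n) (@starK R n)
  _ phiD phiZ phiS _ (gen_dot a)) => //.
exact: star_dot.
Qed.

End HyperbolicCompression.

Theorem theorem3p1 (R : realType) (n : nat) (h : {mpoly R[n]}) (e : 'I_n -> R) :
  irreducible_mpoly h ->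
  (exists d : nat, h \is d.-homog) ->
  hyperbolic h e ->
  ~ neg1_in_SOS h e ->
  exists (m : nat) (M : 'I_n -> 'M[R[i]]_m),
    (forall j, hermitian_mx (M j)) /\
    (forall a : 'I_n -> R,
        hcone h e a <-> psd (\sum_(j < n) ((a j)%:C)%C *: M j)).
Proof.
move=> [hu hirr] _ hyp proper.
have h0 : h != 0 by case: hyp => he _; apply: contraNneq he => ->; rewrite meval0.
have hp : prime_elt h := irreducible_prime (@factorial_mpoly R n) h0 hu hirr.
have [r [M [xi [xi0 Msym Mxi Mpsd]]]] := exists_compression hyp proper.
exact: (spectrahedral_of_compression hp hyp xi0 Msym Mxi Mpsd).
Qed.
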